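(* Let $n>1$. Any pair of inner functions $\phi_1,\phi_2$ on $\mathbb{D}^n$ satisfying $\ker T_{\phi_1}^*\cap\ker T_{\phi_2}^*=\{0\}$ is co-prime, i.e. $\phi_1H^2(\mathbb{D}^n)\cap\phi_2H^2(\mathbb{D}^n)=\phi_1\phi_2H^2(\mathbb{D}^n)$.
   Context: $\mathbb{D}^n$ is the open unit polydisc, $\mathbb{T}^n$ its distinguished boundary, $H^2(\mathbb{D}^n)$ the Hardy space of the polydisc. An inner function on $\mathbb{D}^n$ is a bounded analytic function $\phi$ on $\mathbb{D}^n$ with $|\phi|=1$ a.e. on $\mathbb{T}^n$. For inner $\phi$, $T_\phi$ is the operator of multiplication by $\phi$ on $H^2(\mathbb{D}^n)$, so $\ker T_\phi^*=H^2(\mathbb{D}^n)\ominus\phi H^2(\mathbb{D}^n)$. For $n>1$, inner functions $\phi_1,\phi_2$ on $\mathbb{D}^n$ are called co-prime if $\phi_1H^2(\mathbb{D}^n)\cap\phi_2H^2(\mathbb{D}^n)=\phi_1\phi_2H^2(\mathbb{D}^n)$. *)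

(* Defs.v *)
From HB Require Import structures.
From mathcomp Require Import all_boot all_order all_algebra finmap.
From mathcomp Require Import complex.
From mathcomp Require Import all_classical all_reals all_analysis.
From mathcomp.analysis.showcase Require summability.

Set Implicit Arguments.
Unset Strict Implicit.
Unset Printing Implicit Defensive.

Import Order.TTheory GRing.Theory Num.Theory.
Import numFieldNormedType.Exports.
Local Open Scope classical_set_scope.
Local Open Scope complex_scope.
Local Open Scope ring_scope.

Section unordered_sums.
Context {R : realType} {I : choiceType}.

(* Unordered summation: the limit is along the net of finite subsets of I.
   R[i]^o carries the normed-module topology of the field R[i]. *)
Definition has_sum (a : I -> R[i]) (s : R[i]) : Prop :=
  summability.partial_sum (a : I -> R[i]^o) @ summability.totally
    --> (s : R[i]^o).

Definition usum (a : I -> R[i]) : R[i] :=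
  summability.sum (a : I -> R[i]^o).

End unordered_sums.

Section torus_measure.
Context {R : realType}.

Let lt0_2pi : 0 < 2 * pi :> R.
Proof. by rewrite mulr_gt0 ?pi_gt0. Qed.

Definition cons_pair n (x : measurableTypeR R * n.-tuple (measurableTypeR R)) :
    n.+1.-tuple (measurableTypeR R) :=
  [the n.+1.-tuple (measurableTypeR R) of x.1 :: x.2].

Lemma measurable_cons_pair n : measurable_fun [set: _] (@cons_pair n).
Proof. exact: (measurable_cons measurable_fst measurable_snd). Qed.

HB.instance Definition _ n :=
  isMeasurableFun.Build _ _ _ _ (@cons_pair n) (@measurable_cons_pair n).

(* The normalized Lebesgue measure of T^n, carried by the n-tuples of angles:
   the n-fold product of the uniform probability on [0, 2 pi]. *)
Fixpoint torus_prob (n : nat) : probability (n.-tuple (measurableTypeR R)) R :=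
  match n with
  | 0 => \d_ [tuple]
  | m.+1 => distribution (uniform_prob lt0_2pi \x torus_prob m)%E (@cons_pair m)
  end.

End torus_measure.

Section polydisc.
Context {R : realType} {n : nat}.
Local Notation C := R[i].
Local Notation point := 'rV[C]_n.
Local Notation multiindex := {ffun 'I_n -> nat}.

(* Functions on D^n are represented by total functions on C^n; every notion
   below depends only on their values on D^n. *)
Definition polydisc : set point := [set z | forall i, `|z ord0 i| < 1].

Definition expi (t : R) : C := cos t +i* sin t.

Definition torus_point (t : n.-tuple R) : point := \row_i expi (tnth t i).

Definition monomial (k : multiindex) (z : point) : C :=
  \prod_(i < n) z ord0 i ^+ k i.

Definition analytic_on (D : set point) (f : point -> C) : Prop :=
  forall z, D z -> exists (a : multiindex -> C) (e : R), 0 < e /\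
    forall w : point, (forall i, `|w ord0 i - z ord0 i| < e%:C) ->
      has_sum (fun k => a k * monomial k (w - z)) (f w).

Definition taylor_coefs (f : point -> C) (a : multiindex -> C) : Prop :=
  forall z, polydisc z -> has_sum (fun k => a k * monomial k z) (f z).

Definition hardy2 : set (point -> C) :=
  [set f | exists2 a : multiindex -> C, taylor_coefs f a &
    (\esum_(k in [set: multiindex]) (ComplexField.Normc.normc (a k) ^+ 2)%:E
       < +oo)%E].

(* Taylor coefficients at 0 are unique when they exist; 0 is a junk value for
   functions with no power series expansion on D^n. *)
Definition coefs (f : point -> C) : multiindex -> C :=
  xget (fun=> 0) (taylor_coefs f).

Definition hardy2_inner (f g : point -> C) : C :=
  usum (fun k => coefs f k * (coefs g k)^*).

Definition has_radial_limit (f : point -> C) (zeta : point) (l : C) : Prop :=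
  (f (r%:C *: zeta) : C^o) @[r --> (1 : R)^'-] --> (l : C^o).

(* The values of phi on T^n are its radial limits, which exist a.e. for bounded
   analytic phi by Fatou's theorem. *)
Definition is_inner (phi : point -> C) : Prop :=
  [/\ analytic_on polydisc phi,
      exists M : R, forall z, polydisc z -> `|phi z| <= M%:C &
      {ae torus_prob n, forall t,
         exists2 l, has_radial_limit phi (torus_point t) l & `|l| = 1}].

Definition mul_op (phi f : point -> C) : point -> C := phi \* f.

(* T^* f = h, for the Hilbert space adjoint of T on H^2. *)
Definition adjoint_at (T : (point -> C) -> (point -> C)) (f h : point -> C) :
    Prop :=
  [/\ hardy2 f, hardy2 h &
      forall g, hardy2 g -> hardy2_inner (T g) f = hardy2_inner g h].

Definition ker_adjoint (T : (point -> C) -> (point -> C)) :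
    set (point -> C) := [set f | adjoint_at T f (fun=> 0)].

(* The zero subspace of H^2, namely the functions that vanish on D^n. *)
Definition zero_space : set (point -> C) :=
  [set f | forall z, polydisc z -> f z = 0].

Definition mul_hardy2 (phi : point -> C) : set (point -> C) :=
  [set f | exists2 g, hardy2 g & forall z, polydisc z -> f z = mul_op phi g z].

Definition coprime_inner (phi1 phi2 : point -> C) : Prop :=
  mul_hardy2 phi1 `&` mul_hardy2 phi2 = mul_hardy2 (phi1 \* phi2).

End polydisc.

(* Main.v *)
(** For an inner function with Taylor coefficients [a], letting [r -> 1] in
    Parseval's identity on the tori of radius [r] gives [|phi f| = |f|] on [H^2];
    in terms of coefficients, the translates of [a] are orthonormal in [l^2(N^n)].
    Suppose [phi1 g1 = phi2 g2].  Subtracting from [g1] its projection on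
    [phi2 H^2] reduces the theorem to: if [phi1 w = phi2 g] and [T_phi2^* w = 0]
    then [w = 0].  On the torus put [k = conj(phi2) w]; then [phi2 k = w] and
    [phi1 k = g] are in [H^2].  For [m] outside [N^n] the function
    [u = P (z^m conj(k))], where [P] is the projection on [H^2], satisfies
    [T_phi1^* u = P (z^m conj(g)) = 0] and [T_phi2^* u = P (z^m conj(w)) = 0], so
    [u = 0] by hypothesis and the [m]-th Fourier coefficient of [k] vanishes.  For
    [m] in [N^n] it vanishes because [T_phi2^* w = 0].  Hence [k = 0] and [w = 0].
    The Fourier coefficients of [k] are the numbers [<z^c w, z^d phi2>], which
    depend only on [m = d - c], so the argument takes place in [l^2(N^n)].

    The Taylor series of an inner function on the whole polydisc is obtained from
    the local expansions: if it converges on the polydisc of radius [r < 1], the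
    expansions at the points of that polydisc have a common radius by compactness,
    and Cauchy's estimates for them show that it converges on a larger one. *)
Require Import Defs.
From mathcomp Require Import all_boot all_order all_algebra finmap.
From mathcomp Require Import complex.
From mathcomp Require Import all_classical all_reals all_analysis.
From mathcomp.analysis.showcase Require summability.
From mathcomp Require Import measurable_realfun.
From mathcomp Require Import ring lra.
Set Implicit Arguments.
Unset Strict Implicit.
Unset Printing Implicit Defensive.
Import Order.TTheory GRing.Theory Num.Theory.
Import numFieldNormedType.Exports.
Import ComplexField.Normc.
Local Open Scope classical_set_scope.
Local Open Scope complex_scope.
Local Open Scope ring_scope.

#[local] Arguments normc {R} x : simpl never.
Local Notation Re := complex.Re.
Local Notation Im := complex.Im.

(** * Unordered sums *)

Section normc_theory.
Context {R : realType}.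
Implicit Types x y z : R[i].

(** In [R[i]] the norm is itself a complex number and the order is partial; estimates are therefore
    carried out with the real number [normc z]. *)
Lemma norm_normc z : `|z| = (normc z)%:C.
Proof. by rewrite normc_def; case: z. Qed.

Lemma normc_ge0 z : 0 <= normc z.
Proof. by case: z => a b; exact: sqrtr_ge0. Qed.

Lemma normcB x y : normc (x - y) = normc (y - x).
Proof. by rewrite -normcN opprB. Qed.

Lemma normcR (r : R) : normc r%:C = `|r|.
Proof. by rewrite /normc /= expr0n addr0 sqrtr_sqr. Qed.

Lemma normc_conj z : normc z^* = normc z.
Proof. by apply: complexI; rewrite -!norm_normc normcJ. Qed.

Lemma normcX z k : normc (z ^+ k) = normc z ^+ k.
Proof. by elim: k => [|k IH]; rewrite ?expr0 ?normc1 // !exprS normcM IH. Qed.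

Lemma normc_prod (T : Type) (r : seq T) (P : pred T) (F : T -> R[i]) :
  normc (\prod_(i <- r | P i) F i) = \prod_(i <- r | P i) normc (F i).
Proof. by apply: (big_morph (normc)) => [x y|]; rewrite ?normcM ?normc1. Qed.

Lemma normc_sum (T : Type) (r : seq T) (P : pred T) (F : T -> R[i]) :
  normc (\sum_(i <- r | P i) F i) <= \sum_(i <- r | P i) normc (F i).
Proof.
elim/big_rec2 : _ => [|i y z _ h]; first by rewrite normc0.
by rewrite (le_trans (le_normcD _ _))// lerD2l.
Qed.

Lemma mulc_conj z : z * z^* = (normc z ^+ 2)%:C.
Proof. by rewrite -sqr_normc norm_normc rmorphXn. Qed.

Lemma normc_Re z : `|Re z| <= normc z.
Proof. by rewrite -lecR -norm_normc; exact: normc_ge_Re. Qed.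

Lemma normc_Im z : `|Im z| <= normc z.
Proof.
case: z => a b; rewrite /normc -sqrtr_sqr ler_sqrt ?addr_ge0 ?sqr_ge0//.
by rewrite lerDr sqr_ge0.
Qed.

Lemma normc_small x y : (forall e, 0 < e -> normc (x - y) <= e) -> x = y.
Proof.
move=> h; apply/eqP; rewrite -subr_eq0; apply/eqP/eq0_normc/le_anti.
rewrite normc_ge0 andbT; apply/ler_addgt0Pr => e e0; rewrite add0r; exact: h.
Qed.

End normc_theory.

#[local] Existing Instance summability.totally_filter.

(** * Convergence, algebra and absolute summability of unordered sums *)

Section sums.
Context {R : realType} {I : choiceType}.
Implicit Types (a b : I -> R[i]) (x y : I -> R) (s t c : R[i]) (A B D : {fset I}) (M N e : R).

Lemma has_sumP a s : has_sum a s <->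
  forall e, 0 < e -> exists A, forall B, (A `<=` B)%fset ->
    normc (\sum_(i <- B) a i - s) < e.
Proof.
split=> [/cvgrPdist_lt h e e0 | h].
- have [] := h e%:C; first by rewrite ltcR.
  move=> A _ hA; exists A => B /hA /=.
  rewrite /summability.partial_sum -(@big_seq_fsetE _ _ _ _ _ predT a) /=.
  by rewrite norm_normc ltcR normcB.
- apply/cvgrPdist_lt => e e0.
  have e0' : 0 < Re e by move: e0; rewrite ltcE => /andP[].
  have -> : e = (Re e)%:C by rewrite RRe_real// gtr0_real.
  have [A hA] := h _ e0'; exists A => // B /= AB.
  rewrite /summability.partial_sum -(@big_seq_fsetE _ _ _ _ _ predT a) /=.
  by rewrite norm_normc ltcR normcB; exact: hA.
Qed.

Lemma has_sum_unique a s t : has_sum a s -> has_sum a t -> s = t.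
Proof.
move=> /has_sumP hs /has_sumP ht; apply: normc_small => e e0.
have [A hA] := hs (e / 2) ltac:(by rewrite divr_gt0).
have [B hB] := ht (e / 2) ltac:(by rewrite divr_gt0).
have {}hA := hA (A `|` B)%fset (fsubsetUl _ _).
have {}hB := hB (A `|` B)%fset (fsubsetUr _ _).
set u := \sum_(_ <- _) _ in hA hB.
rewrite (_ : s - t = (s - u) + (u - t)); last by ring.
rewrite (le_trans (le_normcD _ _))// (splitr e) ltW// ltrD//.
by rewrite normcB.
Qed.

Lemma usumE a s : has_sum a s -> usum a = s.
Proof. by move=> h; rewrite /usum /summability.sum; apply: cvg_lim h; exact: norm_hausdorff. Qed.

Lemma eq_has_sum a b s : a =1 b -> has_sum a s -> has_sum b s.
Proof. by move=> /funext ->. Qed.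

Lemma has_sumD a b s t : has_sum a s -> has_sum b t ->
  has_sum (fun i => a i + b i) (s + t).
Proof.
move=> /has_sumP hs /has_sumP ht; apply/has_sumP => e e0.
have [A hA] := hs (e / 2) ltac:(by rewrite divr_gt0).
have [B hB] := ht (e / 2) ltac:(by rewrite divr_gt0).
exists (A `|` B)%fset => D; rewrite fsubUset => /andP[/hA h1 /hB h2].
rewrite big_split /= opprD addrACA (le_lt_trans (le_normcD _ _))//.
by rewrite (splitr e) ltrD.
Qed.

Lemma has_sumZ c a s : has_sum a s -> has_sum (fun i => c * a i) (c * s).
Proof.
move=> /has_sumP hs; apply/has_sumP => e e0.
have c1 : 0 < normc c + 1 by rewrite ltr_wpDl// normc_ge0.
have [A hA] := hs (e / (normc c + 1)) ltac:(by rewrite divr_gt0).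
exists A => B /hA; rewrite ltr_pdivlMr// => h.
rewrite -mulr_sumr -mulrBr normcM (le_lt_trans _ h)// mulrC.
by rewrite ler_wpM2l ?normc_ge0// lerDl.
Qed.

Lemma has_sumN a s : has_sum a s -> has_sum (fun i => - a i) (- s).
Proof.
move=> /(has_sumZ (c := -1)); rewrite mulN1r; apply: eq_has_sum => i.
by rewrite mulN1r.
Qed.

Lemma has_sumB a b s t : has_sum a s -> has_sum b t ->
  has_sum (fun i => a i - b i) (s - t).
Proof. by move=> hs /has_sumN; exact: has_sumD. Qed.

Lemma has_sum_fin A a : (forall i, i \notin A -> a i = 0) ->
  has_sum a (\sum_(i <- A) a i).
Proof.
move=> h; apply/has_sumP => e e0; exists A => B AB.
rewrite -(big_fset_incl _ AB) ?subrr ?normc0// => i _; exact: h.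
Qed.

Lemma has_sum0 : has_sum (fun _ : I => 0 : R[i]) 0.
Proof. by have := @has_sum_fin fset0 (fun=> 0) (fun _ _ => erefl); rewrite big_seq_fset0. Qed.

Lemma has_sum_sum (T : Type) (r : seq T) (F : T -> I -> R[i]) (s : T -> R[i]) :
  (forall j, has_sum (F j) (s j)) ->
  has_sum (fun i => \sum_(j <- r) F j i) (\sum_(j <- r) s j).
Proof.
move=> h; elim: r => [|j r IH].
  by rewrite big_nil; apply: eq_has_sum has_sum0 => i; rewrite big_nil.
by rewrite big_cons; apply: eq_has_sum (has_sumD (h j) IH) => i; rewrite big_cons.
Qed.


(** For nonnegative [x] this is summability together with a bound on the sum, kept inside [R]. *)
Definition bsum (x : I -> R) M := forall B, \sum_(i <- B) x i <= M.

Lemma bsum_ge0 x M : bsum x M -> 0 <= M.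
Proof. by move=> /(_ fset0); rewrite big_seq_fset0. Qed.

Lemma bsum1 x M i : bsum x M -> x i <= M.
Proof. by move=> /(_ [fset i]%fset); rewrite big_seq_fset1. Qed.

Lemma bsum_le x y M N : (forall i, x i <= y i) -> M <= N ->
  bsum y M -> bsum x N.
Proof. by move=> xy MN h B; rewrite (le_trans _ MN)// (le_trans _ (h B))// ler_sum. Qed.

Lemma bsumZ x M e : 0 <= e -> bsum x M -> bsum (fun i => e * x i) (e * M).
Proof. by move=> e0 h B; rewrite -mulr_sumr ler_wpM2l. Qed.

Lemma bsumD x y M N : bsum x M -> bsum y N ->
  bsum (fun i => x i + y i) (M + N).
Proof. by move=> h k B; rewrite big_split lerD. Qed.

Lemma sum_fsetU (V : nmodType) (x : I -> V) A B : {in A, forall i, i \notin B} ->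
  \sum_(i <- (A `|` B)%fset) x i = \sum_(i <- A) x i + \sum_(i <- B) x i.
Proof.
move=> AB; rewrite (big_fsetID _ (mem A)) /=; congr (_ + _); apply: eq_fbigl => i.
  by rewrite !inE /=; case: (i \in A); rewrite ?andbF.
by rewrite !inE /=; case: (boolP (i \in A)) => [/AB/negPf ->|]; rewrite ?andbT.
Qed.

Lemma ler_sum_fset x A B : (forall i, 0 <= x i) -> (A `<=` B)%fset ->
  \sum_(i <- A) x i <= \sum_(i <- B) x i.
Proof.
move=> x0 AB; rewrite -(fsetID A B) (fsetIidPr AB) sum_fsetU; last by move=> i; rewrite !inE => ->.
by rewrite lerDl sumr_ge0.
Qed.

Let partials (x : I -> R) : set R := [set \sum_(i <- A) x i | A in [set: {fset I}]].

Let partials_sup x M : bsum x M -> has_sup (partials x).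
Proof.
move=> h; split; first by exists (\sum_(i <- fset0) x i), fset0.
by exists M => _ [A _ <-].
Qed.

Let partials_adherent x M e : bsum x M -> 0 < e ->
  exists A, sup (partials x) - e < \sum_(i <- A) x i.
Proof. by move=> /partials_sup hs e0; have [_ [A _ <-] hA] := sup_adherent e0 hs; exists A. Qed.

Let partials_ub x M B : bsum x M -> \sum_(i <- B) x i <= sup (partials x).
Proof. by move=> /partials_sup h; apply: ub_le_sup; [case: h | exists B]. Qed.

(** Take [A] whose partial sum is within [e] of the supremum: a finite set disjoint from [A] can
    only add less than [e]. *)
Lemma bsum_tail x M e : (forall i, 0 <= x i) -> bsum x M -> 0 < e ->
  exists A, forall B, {in B, forall i, i \notin A} -> \sum_(i <- B) x i < e.
Proof.
move=> x0 h e0; have [A hA] := partials_adherent h e0; exists A => B AB.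
have := partials_ub (B `|` A)%fset h; rewrite sum_fsetU//.
by move: hA; lra.
Qed.

Lemma bsum_has_sumR x M : (forall i, 0 <= x i) -> bsum x M ->
  exists s : R, has_sum (fun i => (x i)%:C) s%:C.
Proof.
move=> x0 h; exists (sup (partials x)); apply/has_sumP => e e0.
have [A hA] := partials_adherent h e0; exists A => B AB.
rewrite -rmorph_sum -rmorphB normcR.
have := partials_ub B h; have := ler_sum_fset x0 AB.
by move: hA => ? ? ?; rewrite ler0_norm; lra.
Qed.

Lemma normc_le_ReIm (z : R[i]) : normc z <= `|Re z| + `|Im z|.
Proof.
rewrite [in X in X <= _](complexE z) (le_trans (le_normcD _ _))// normcM !normcR.
by rewrite /normc /= expr0n expr1n add0r sqrtr1 mul1r.
Qed.

(** The real and imaginary parts are split into positive and negative parts; these nonnegative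
    families are dominated by the modulus. *)
Lemma bsum_has_sum a M : bsum (normc \o a) M -> exists s, has_sum a s.
Proof.
move=> h.
have pos (f : R[i] -> R) : (forall z, `|f z| <= normc z) ->
    exists s, has_sum (fun i => (f (a i))%:C) s.
  move=> hf.
  have hp (g : R -> R) : (forall r, 0 <= g r <= `|r|) ->
      exists s : R, has_sum (fun i => (g (f (a i)))%:C) s%:C.
    move=> hg; apply: (@bsum_has_sumR _ M); first by move=> i; have /andP[] := hg (f (a i)).
    apply: bsum_le h => // i /=; apply: le_trans (hf _).
    by have /andP[] := hg (f (a i)).
  have [s hs] := hp (Num.max 0) (fun r => ltac:(by rewrite le_max lexx ge_max normr_ge0 ler_norm)).
  have [t ht] := hp (fun r => Num.max 0 (- r))
    (fun r => ltac:(by rewrite le_max lexx ge_max normr_ge0 -normrN ler_norm)).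
  exists (s%:C - t%:C); apply: eq_has_sum (has_sumB hs ht) => i.
  rewrite -rmorphB; congr (_%:C); case: (leP 0 (f (a i))) => hi.
    by rewrite max_l ?subr0// oppr_le0.
  by rewrite max_r ?sub0r ?opprK// oppr_ge0 ltW.
have [s hs] := pos _ (@normc_Re R).
have [t ht] := pos _ (@normc_Im R).
exists (s + 'i%C * t); apply: eq_has_sum (has_sumD hs (has_sumZ (c := 'i%C) ht)) => i.
by rewrite -complexE.
Qed.

Lemma has_sum_le a s M : bsum (normc \o a) M -> has_sum a s -> normc s <= M.
Proof.
move=> h /has_sumP hs; apply/ler_addgt0Pr => e e0.
have [A /(_ _ (fsubset_refl _)) hA] := hs _ e0.
rewrite -[s](subrKC (\sum_(i <- A) a i)) (le_trans (le_normcD _ _))//.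
rewrite lerD//; last by rewrite normcB ltW.
by rewrite (le_trans (normc_sum _ _ _))//; exact: h.
Qed.

(** Unordered convergence is absolute. Off a suitable finite [A] every finite sum has modulus at
    most 2; grouping indices by the sign of the real part, then of the imaginary part, bounds each
    sum of absolute values by 4. *)
Lemma has_sum_bsum a s : has_sum a s -> exists M, bsum (normc \o a) M.
Proof.
move=> /has_sumP /(_ 1 ltr01)[A hA].
have hD D : {in D, forall i, i \notin A} -> normc (\sum_(i <- D) a i) <= 2.
  move=> AD; have h1 := hA A (fsubset_refl _).
  have := hA (D `|` A)%fset (fsubsetUr _ _); rewrite sum_fsetU// => h2.
  rewrite (_ : \sum_(i <- D) a i = (\sum_(i <- D) a i + \sum_(i <- A) a i - s)
     - (\sum_(i <- A) a i - s)); last by ring.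
  rewrite (le_trans (le_normcD _ _))// normcN (_ : 2 = 1 + 1 :> R)//.
  by rewrite lerD// ltW.
have part (f : R[i] -> R) D : {morph f : y z / y + z} -> f 0 = 0 ->
    (forall z, `|f z| <= normc z) ->
    {in D, forall i, i \notin A} -> \sum_(i <- D) `|f (a i)| <= 4.
  move=> fD f0 hf AD.
  have hD2 (P : pred I) : `|\sum_(i <- D | P i) f (a i)| <= 2.
    rewrite -(big_morph f fD f0) (le_trans (hf _))// big_fset_condE hD// => i.
    by rewrite !inE => /andP[/AD].
  rewrite (bigID (fun i => 0 <= f (a i))) /= (_ : 4 = 2 + 2); last by ring.
  apply: lerD.
    apply: le_trans (hD2 (fun i => 0 <= f (a i))).
    by rewrite (eq_bigr (fun i => f (a i))) ?ler_norm// => i /ger0_norm.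
  apply: le_trans (hD2 (fun i => ~~ (0 <= f (a i)))).
  rewrite (eq_bigr (fun i => - f (a i))) => [|i].
    by rewrite sumrN -[leRHS]normrN ler_norm.
  by rewrite -ltNge => /ltr0_norm.
exists (\sum_(i <- A) normc (a i) + (4 + 4)) => B.
rewrite -(fsetID A B) sum_fsetU; last first.
  by move=> i; rewrite !inE => /andP[_ ->].
apply: lerD; first by apply: ler_sum_fset => [i|]; rewrite ?normc_ge0 ?fsubsetIr.
apply: (@le_trans _ _ (\sum_(i <- (B `\` A)%fset) (`|Re (a i)| + `|Im (a i)|))).
  by apply: ler_sum => i _; exact: normc_le_ReIm.
have AD : {in (B `\` A)%fset, forall i, i \notin A} by move=> i; rewrite !inE => /andP[].
rewrite big_split /= lerD//.
  have ReD : {morph @complex.Re R : y z / y + z} by case=> ? ? [].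
  exact: (part _ _ ReD erefl (@normc_Re R) AD).
have ImD : {morph @complex.Im R : y z / y + z} by case=> ? ? [].
exact: (part _ _ ImD erefl (@normc_Im R) AD).
Qed.

Lemma bsum_off x M A : (forall B, {in B, forall i, i \notin A} -> \sum_(i <- B) x i <= M) ->
  {in A, forall i, x i = 0} -> bsum x M.
Proof.
move=> h x0 B; rewrite -(fsetID A B) sum_fsetU; last first.
  by move=> i; rewrite !inE => /andP[_ ->].
rewrite big_seq big1 ?add0r; last by move=> i; rewrite !inE => /andP[_ /x0].
by apply: h => i; rewrite !inE => /andP[].
Qed.

End sums.

(** * Regrouping a sum along the fibres of a map *)

Section regroup.
Context {R : realType} {I K : choiceType} (p : K -> I).
Implicit Types (a : K -> R[i]).

(** Let [A] carry the absolute sum up to [e / 2]. If [D] contains the image of [A], then [s] minus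
    the sum of [t] over [D] is the sum of those [a k] with [p k] outside [D], and all these [k] lie
    outside [A]. *)
Lemma has_sum_regroup a (t : I -> R[i]) s : has_sum a s ->
  (forall i, has_sum (fun k => if p k == i then a k else 0) (t i)) ->
  has_sum t s.
Proof.
move=> hs ht; have [M hM] := has_sum_bsum hs; apply/has_sumP => e e0.
have [A hA] := bsum_tail (fun i => normc_ge0 (a i)) hM (divr_gt0 e0 (ltr0n _ 2)).
exists (p @` A)%fset => D AD.
have hb := has_sumB hs (has_sum_sum (r := D) ht).
rewrite normcB; apply: (@le_lt_trans _ _ (e / 2)); last by rewrite ltr_pdivrMr// ltr_pMr// ltr1n.
apply: has_sum_le hb.
have E k : a k - \sum_(j <- D) (if p k == j then a k else 0)
    = if p k \in D then 0 else a k.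
  case: ifPn => pk.
    rewrite (big_fsetD1 _ pk) /= eqxx big_seq big1 ?addr0 ?subrr// => j.
    by rewrite !inE eq_sym => /andP[/negPf ->].
  rewrite big_seq big1 ?subr0// => j jD; case: eqP => // pkj.
  by rewrite pkj jD in pk.
apply: (@bsum_off _ _ _ _ A) => [B BA|k kA] /=; last first.
  by rewrite E (fsubsetP AD) ?normc0// in_imfset.
apply: le_trans (ltW (hA B BA)); apply: ler_sum => k _ /=; rewrite E.
by case: ifP => // _; rewrite normc0 normc_ge0.
Qed.

Lemma bsum_fibers (x : K -> R) (y : I -> R) M : bsum y M ->
  (forall k, 0 <= x k) ->
  (forall i (B : {fset K}), {in B, forall k, p k = i} -> \sum_(k <- B) x k <= y i) ->
  bsum x M.
Proof.
move=> hy x0 h B; apply: le_trans (hy (p @` B)%fset).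
rewrite (eq_big_seq (fun k => \sum_(i <- (p @` B)%fset) (if p k == i then x k else 0))).
  rewrite exchange_big /=; apply: ler_sum => i _.
  rewrite -big_mkcond big_fset_condE; apply: h => k; rewrite !inE.
  by move=> /andP[_ /eqP].
move=> k kB /=; rewrite (big_fsetD1 (p k)) /= ?in_imfset// eqxx big_seq big1 ?addr0// => j.
by rewrite !inE eq_sym => /andP[/negPf ->].
Qed.

Lemma has_sum_inj a (t : I -> R[i]) s : injective p ->
  (forall k, t (p k) = a k) -> (forall i, (forall k, p k <> i) -> t i = 0) ->
  has_sum a s -> has_sum t s.
Proof.
move=> pI tp t0 hs; apply: has_sum_regroup hs _ => i.
have [[k pk]|h] := pselect (exists k, p k = i).
  have := @has_sum_fin R K [fset k]%fset (fun k => if p k == i then a k else 0).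
  rewrite big_seq_fset1 pk eqxx -pk tp; apply => k'.
  by rewrite !inE inj_eq// => /negPf ->.
rewrite t0; last by move=> k pk; apply: h; exists k.
by apply: eq_has_sum has_sum0 => k; case: eqP => // pk; case: h; exists k.
Qed.

End regroup.

(** * Iterated summation over a product *)

Section pairs.
Context {R : realType} {I J : choiceType}.
Implicit Types (A : I * J -> R[i]).

Lemma has_sum_fst A (t : I -> R[i]) s : has_sum A s ->
  (forall i, has_sum (fun j => A (i, j)) (t i)) -> has_sum t s.
Proof.
move=> hs ht; apply: (has_sum_regroup (p := fst)) hs _ => i.
apply: (has_sum_inj (p := pair i)) (ht i) => [? ? []//|k|[i' j] h] /=.
  by rewrite eqxx.
by case: eqP => // E; case: (h j); rewrite E.
Qed.

Lemma has_sum_snd A (t : J -> R[i]) s : has_sum A s ->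
  (forall j, has_sum (fun i => A (i, j)) (t j)) -> has_sum t s.
Proof.
move=> hs ht; apply: (has_sum_regroup (p := snd)) hs _ => j.
apply: (has_sum_inj (p := fun i => (i, j))) (ht j) => [? ? []//|k|[i j'] h] /=.
  by rewrite eqxx.
by case: eqP => // E; case: (h i); rewrite E.
Qed.

(** Tonelli's theorem for bounds. With [bsum_has_sum] it gives the summability over [I * J] from
    which [has_sum_fst] and [has_sum_snd] exchange the order of summation. *)
Lemma bsum_pair (x : I * J -> R) (y : I -> R) M : (forall k, 0 <= x k) ->
  bsum y M -> (forall i, bsum (fun j => x (i, j)) (y i)) -> bsum x M.
Proof.
move=> x0 hy h; apply: (bsum_fibers (p := fst)) hy x0 _ => i B hB.
apply: le_trans (h i (snd @` B)%fset).
rewrite big_imfset /=; last first.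
  by move=> [a b] [c d] /hB /= -> /hB /= -> ->.
by rewrite big_seq [leRHS]big_seq ler_sum// => -[a b] /hB /= ->.
Qed.

End pairs.

(** * Multi-indices *)

Local Notation mi n := {ffun 'I_n -> nat}.

Section multiindex.
Context {n : nat}.
Implicit Types (k l j : mi n).

Definition mdeg k := (\sum_i k i)%N.
Definition mle k l := [forall i, (k i <= l i)%N].
(** Truncated subtraction, a true difference only when [mle l k]. *)
Definition msub k l : mi n := [ffun i => (k i - l i)%N].
Definition mbin k j := (\prod_i 'C(k i, j i))%N.
Definition madd k l : mi n := [ffun i => (k i + l i)%N].
Definition mi0 : mi n := [ffun => 0%N].

Lemma maddC : commutative madd.
Proof. by move=> k l; apply/ffunP => i; rewrite !ffunE addnC. Qed.

Lemma maddA : associative madd.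
Proof. by move=> k l j; apply/ffunP => i; rewrite !ffunE addnA. Qed.

Lemma madd0 k : madd k mi0 = k.
Proof. by apply/ffunP => i; rewrite !ffunE addn0. Qed.

Lemma maddI k : injective (madd k).
Proof. by move=> l j /ffunP h; apply/ffunP => i; have := h i; rewrite !ffunE => /addnI. Qed.

Lemma msubK k l : mle l k -> madd l (msub k l) = k.
Proof. by move=> /forallP h; apply/ffunP => i; rewrite !ffunE subnKC. Qed.

Lemma maddK k l : msub (madd l k) l = k.
Proof. by apply/ffunP => i; rewrite !ffunE addKn. Qed.

Lemma mle_add k l : mle l (madd l k).
Proof. by apply/forallP => i; rewrite ffunE leq_addr. Qed.

Lemma mle_addP k l : mle l k -> exists j, k = madd l j.
Proof. by move=> h; exists (msub k l); rewrite msubK. Qed.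

Lemma mle_add2l k l j : mle (madd k l) (madd k j) = mle l j.
Proof. by apply: eq_forallb => i; rewrite !ffunE leq_add2l. Qed.

Lemma mle_trans : transitive mle.
Proof.
move=> k l j /forallP h /forallP h'; apply/forallP => i; exact: leq_trans (h i) (h' i).
Qed.

Lemma mdegD k l : mdeg (madd k l) = (mdeg k + mdeg l)%N.
Proof. by rewrite /mdeg -big_split; apply: eq_bigr => i _; rewrite ffunE. Qed.

Lemma mbin_eq0 k j : ~~ mle j k -> mbin k j = 0%N.
Proof.
rewrite negb_forall => /existsP[m]; rewrite -ltnNge => h.
by rewrite /mbin (bigD1 m)//= bin_small.
Qed.

Definition of_ords N (g : {ffun 'I_n -> 'I_N}) : mi n := [ffun i => g i : nat].

(** Boxes are cofinal among the finite sets of multi-indices, and sums of products over a box factor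
    into one-variable sums. *)
Definition box N : {fset mi n} := [fset of_ords g | g in {ffun 'I_n -> 'I_N}]%fset.

Lemma mem_box k N : (k \in box N) = [forall i, (k i < N)%N].
Proof.
apply/imfsetP/forallP => [[g _ ->] i|h]; first by rewrite ffunE ltn_ord.
by exists [ffun i => Ordinal (h i)] => //; apply/ffunP => i; rewrite !ffunE.
Qed.

Lemma box_sub M N : (M <= N)%N -> (box M `<=` box N)%fset.
Proof.
move=> MN; apply/fsubsetP => k; rewrite !mem_box => /forallP h.
by apply/forallP => i; exact: leq_trans (h i) MN.
Qed.

Lemma box_cofinal (A : {fset mi n}) : exists N, (A `<=` box N)%fset.
Proof.
exists (\max_(k <- A) \max_i k i).+1%N; apply/fsubsetP => k kA.
rewrite mem_box; apply/forallP => i; rewrite ltnS.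
apply: (bigmaxn_sup_seq k) => //; exact: leq_bigmax.
Qed.

Lemma sum_box (V : comPzSemiRingType) N (F : 'I_n -> nat -> V) :
  \sum_(k <- box N) \prod_i F i (k i) = \prod_i \sum_(j < N) F i j.
Proof.
rewrite bigA_distr_bigA big_imfset /=; last first.
  move=> g h _ _ /ffunP E; apply/ffunP => i; apply: val_inj.
  by have := E i; rewrite !ffunE.
by rewrite big_enum; apply: eq_bigr => g _; apply: eq_bigr => i _; rewrite ffunE.
Qed.

End multiindex.

(** * Monomials and geometric series in several variables *)

Section multi_sums.
Context {R : realType} {n : nat}.
Implicit Types (k l j : mi n) (z w h v : 'rV[R[i]]_n) (r : R).

Lemma monomialD k l z : monomial (madd k l) z = monomial k z * monomial l z.
Proof. by rewrite -big_split; apply: eq_bigr => i _; rewrite ffunE exprD. Qed.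

Lemma normc_monomial k z r : (forall i, normc (z ord0 i) <= r) ->
  normc (monomial k z) <= r ^+ mdeg k.
Proof.
move=> h; rewrite normc_prod expr_sum; apply: ler_prod => i _.
by rewrite normcX exprn_ge0 ?normc_ge0//= lerXn2r ?nnegrE ?normc_ge0// (le_trans _ (h i)) ?normc_ge0.
Qed.

Lemma normc_monomial_eq k z r : (forall i, normc (z ord0 i) = r) ->
  normc (monomial k z) = r ^+ mdeg k.
Proof. by move=> h; rewrite normc_prod expr_sum; apply: eq_bigr => i _; rewrite normcX h. Qed.

Lemma monomial_const k r : monomial k (const_mx r%:C) = (r ^+ mdeg k)%:C.
Proof.
rewrite /monomial expr_sum rmorph_prod; apply: eq_bigr => i _.
by rewrite mxE rmorphXn.
Qed.

Lemma monomialZ k (c : R[i]) z : monomial k (c *: z) = c ^+ mdeg k * monomial k z.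
Proof.
rewrite /monomial expr_sum -big_split; apply: eq_bigr => i _.
by rewrite mxE exprMn.
Qed.

(** Over a box the sum is a product of [n] finite geometric sums, each at most [(1 - r)^-1]. *)
Lemma bsum_geo r : 0 <= r < 1 -> bsum (fun k => r ^+ mdeg k) ((1 - r)^-1 ^+ n).
Proof.
move=> /andP[r0 r1] A; have [N AN] := box_cofinal A.
apply: le_trans (ler_sum_fset _ AN) _ => [k|]; first by rewrite exprn_ge0.
under eq_bigr do rewrite expr_sum.
rewrite (sum_box N (fun _ => GRing.exp r)) -[in leRHS](card_ord n) -prodr_const.
apply: ler_prod => i _; rewrite sumr_ge0 /=; last by move=> j _; rewrite exprn_ge0.
rewrite -[leRHS]mul1r ler_pdivlMr ?subr_gt0// mulrC -opprB mulNr -subrX1 opprB.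
by rewrite gerBl exprn_ge0.
Qed.

(** The binomial formula in each coordinate. Any box containing [k] will do, since [mbin k j]
    vanishes unless [j] is below [k]. *)
Lemma multibinomial N k h v : k \in box N ->
  \sum_(j <- box N) (mbin k j)%:R * monomial (msub k j) h * monomial j v
  = monomial k (h + v).
Proof.
rewrite mem_box => /forallP kN.
under eq_bigr do rewrite natr_prod -!big_split /=.
pose F (i : 'I_n) (j : nat) :=
  'C(k i, j)%:R * h ord0 i ^+ (k i - j) * v ord0 i ^+ j.
rewrite (eq_bigr (fun j : mi n => \prod_i F i (j i))); last first.
  by move=> j _; apply: eq_bigr => i _; rewrite !ffunE.
rewrite sum_box; apply: eq_bigr => i _; rewrite mxE exprDn.
rewrite [LHS](bigID (fun j : 'I_N => (j < (k i).+1)%N)) /= [X in _ + X]big1 ?addr0; last first.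
  by move=> j; rewrite -leqNgt => hj; rewrite /F bin_small// !mul0r.
rewrite -(big_ord_widen _ (F i) (kN i)); apply: eq_bigr => j _.
by rewrite /F -mulrA mulr_natl.
Qed.

Lemma has_sum_box (a : mi n -> R[i]) (s : R[i]) : has_sum a s ->
  forall e, 0 < e -> exists N0, forall N, (N0 <= N)%N ->
    normc (\sum_(k <- box N) a k - s) < e.
Proof.
move=> /has_sumP h e /h[A hA]; have [N0 AN] := box_cofinal A.
exists N0 => N N0N; apply: hA; exact: fsubset_trans AN (box_sub N0N).
Qed.

Lemma bsum_box (x : mi n -> R) M : (forall k, 0 <= x k) ->
  (forall N, \sum_(k <- box N) x k <= M) -> bsum x M.
Proof. by move=> x0 h A; have [N /(ler_sum_fset x0)/le_trans] := box_cofinal A; apply. Qed.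

(** Abel's lemma: comparison with the geometric series of ratio [r / s]. *)
Lemma bsum_powers (a : mi n -> R[i]) (K s r : R) :
  (forall k, normc (a k) * s ^+ mdeg k <= K) -> 0 <= r < s ->
  exists M, bsum (fun k => normc (a k) * r ^+ mdeg k) M.
Proof.
move=> h /andP[r0 rs]; have s0 := le_lt_trans r0 rs.
have q : 0 <= r / s < 1 by apply/andP; split; rewrite ?ltr_pdivrMr ?mul1r// divr_ge0// ltW.
have K0 : 0 <= K by rewrite (le_trans _ (h mi0))// mulr_ge0 ?normc_ge0// exprn_ge0// ltW.
exists (K * (1 - r / s)^-1 ^+ n); apply: bsum_le (bsumZ K0 (bsum_geo q)) => // k.
rewrite expr_div_n mulrA ler_pdivlMr ?exprn_gt0// mulrAC.
by rewrite ler_wpM2r ?exprn_ge0.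
Qed.

End multi_sums.

(** * Integration on the torus *)

Lemma prob_bounded_integrable (R : realType) d (T : measurableType d)
    (P : probability T R) (f : T -> R) K :
  measurable_fun setT f -> (forall x, `|f x| <= K) ->
  P.-integrable setT (EFin \o f).
Proof.
move=> mf fK; apply: measurable_bounded_integrable => //.
  exact: le_lt_trans (probability_le1 P measurableT) (ltry _).
by exists K; split; [exact: num_real|move=> M KM x _; exact: le_trans (fK x) (ltW KM)].
Qed.

Lemma prob_bounded_cvg (R : realType) d (T : measurableType d)
    (P : probability T R) (f_ : nat -> T -> R) (f : T -> R) K :
  (forall m, measurable_fun setT (f_ m)) -> measurable_fun setT f ->
  (forall m x, `|f_ m x| <= K) ->
  {ae P, forall x, f_ ^~ x @ \oo --> f x} ->
  (\int[P]_x (f_ m x)%:E)%E @[m --> \oo] --> (\int[P]_x (f x)%:E)%E.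
Proof.
move=> mf_ mf fK ff.
have mfE_ m : measurable_fun setT (EFin \o f_ m) by apply/measurable_EFinP; exact: mf_.
have mfE : measurable_fun setT (EFin \o f) by apply/measurable_EFinP.
have ffE : {ae P, forall x, setT x -> (EFin \o f_ m) x @[m --> \oo] --> (EFin \o f) x}.
  by apply: filterS ff => x h _; apply: cvg_EFin => //; exact: nearW.
have iK : P.-integrable setT (cst K%:E) by exact: finite_measure_integrable_cst.
have bK : {ae P, forall x m, setT x -> (`|(EFin \o f_ m) x| <= cst K%:E x)%E}.
  by apply: aeW => x m _; rewrite lee_fin.
by have [_ _] := dominated_convergence measurableT mfE_ mfE ffE iK bK.
Qed.

(** * Integrals of characters over the circle *)

Section circle_integral.
Context {R : realType}.

Lemma expiD (x y : R) : expi (x + y) = expi x * expi y.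
Proof.
rewrite /expi cosD sinD; apply/eqP.
by rewrite eq_complex /= addrC eqxx [cos x * sin y + _]addrC eqxx.
Qed.

Lemma expi0 : expi (0 : R) = 1.
Proof. by rewrite /expi cos0 sin0. Qed.

Lemma normc_expi (x : R) : normc (expi x) = 1.
Proof. by rewrite /normc /= cos2Dsin2 sqrtr1. Qed.

Lemma expiX (x : R) k : expi x ^+ k = expi (k%:R * x).
Proof.
elim: k => [|k IH]; first by rewrite mul0r expi0.
by rewrite exprS IH -expiD; congr expi; rewrite -natr1; ring.
Qed.

Lemma expi_conj (x : R) : (expi x)^* = expi (- x).
Proof. by rewrite /expi cosN sinN. Qed.

Lemma Re_expi (c : R[i]) (x : R) : Re (c * expi x) = Re c * cos x - Im c * sin x.
Proof. by case: c. Qed.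

(** An antiderivative of [K + Re (c * expi (m * x))]. *)
Let F (c : R[i]) (K m : R) : R -> R :=
  K *: id + ((Re c / m) *: (sin \o ( *%R m)) + (Im c / m) *: (cos \o ( *%R m))).

Let is_derive_F (c : R[i]) (K m x : R) : m != 0 ->
  is_derive x 1 (F c K m) (K + Re (c * expi (m * x))).
Proof.
move=> m0; rewrite Re_expi.
have dm : is_derive x (1 : R) ( *%R m) m.
  rewrite (_ : ( *%R m) = m *: id)//; apply: is_derive_eq.
  by rewrite /GRing.scale/= mulr1.
have ds := @is_derive1_comp R sin ( *%R m) x _ _ (is_derive_sin (m * x)) dm.
have dc := @is_derive1_comp R cos ( *%R m) x _ _ (is_derive_cos (m * x)) dm.
apply: is_derive_eq.
by rewrite /GRing.scale/=; field.
Qed.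

Let FE c K m x : F c K m x = K * x + (Re c / m * sin (m * x) + Im c / m * cos (m * x)).
Proof. by []. Qed.

Lemma continuous_Re_expi (c : R[i]) (m : R) : continuous (fun x => Re (c * expi (m * x))).
Proof.
move=> x; rewrite (_ : (fun x => _) = (fun x => Re c * cos (m * x) - Im c * sin (m * x))); last first.
  by apply/funext => y; rewrite Re_expi.
apply: cvgB; apply: cvgMr.
  apply: (@continuous_comp _ _ _ ( *%R m) cos x); first exact: mulrl_continuous.
  exact: continuous_cos.
apply: (@continuous_comp _ _ _ ( *%R m) sin x); first exact: mulrl_continuous.
exact: continuous_sin.
Qed.

(** The constant [K = normc c] is added to make the integrand nonnegative, as [integral_uniform]
    asks, and is subtracted at the end; [F] takes care of the rest by periodicity. *)
Lemma integral_uniform_expi (h : 0 < 2 * pi :> R) (c : R[i]) (m : R) :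
  m != 0 -> expi (m * (2 * pi)) = 1 ->
  (\int[uniform_prob h]_x (Re (c * expi (m * x)))%:E = 0)%E.
Proof.
move=> m0 m1; set K := normc c.
have bd x : `|Re (c * expi (m * x))| <= K.
  by rewrite (le_trans (normc_Re _))// normcM normc_expi mulr1.
have mf : measurable_fun setT (fun x => Re (c * expi (m * x))).
  by apply: continuous_measurable_fun; exact: continuous_Re_expi.
have dF x := is_derive_F c K x m0.
have : (\int[uniform_prob h]_x (K + Re (c * expi (m * x)))%:E = K%:E)%E.
  rewrite integral_uniform; last 2 first.
  - by apply/measurable_EFinP; exact: measurable_funD.
  - by move=> x; rewrite lee_fin -lerBlDl sub0r; have := bd x; rewrite ler_norml => /andP[].
  have cF : continuous (F c K m).
    by move=> x; apply/differentiable_continuous/derivable1_diffP; exact: (@ex_derive _ _ _ _ _ _ _ (dF x)).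
  rewrite (continuous_FTC2 (F := F c K m))//; last 3 first.
  - apply: continuous_subspaceT => x; apply: cvgD; first exact: cvg_cst.
    exact: continuous_Re_expi.
  - split => [x _||]; first exact: (@ex_derive _ _ _ _ _ _ _ (dF x)).
    + exact/cvg_at_right_filter/cF.
    + exact/cvg_at_left_filter/cF.
  - by move=> x _; rewrite derive1E; exact: (@derive_val _ _ _ _ _ _ _ (dF x)).
  have [c1 s1] : cos (m * (2 * pi)) = 1 /\ sin (m * (2 * pi)) = 0 by case: m1.
  rewrite -EFinB -EFinM !FE c1 s1 !mulr0 sin0 cos0; congr (_%:E).
  have : pi != 0 :> R by rewrite gt_eqF ?pi_gt0.
  by move: (pi : R) => p p0; field; rewrite m0.
have int : (uniform_prob h).-integrable setT (EFin \o (fun x => Re (c * expi (m * x)))).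
  exact: (prob_bounded_integrable (uniform_prob h) mf bd).
under eq_integral do rewrite EFinD.
rewrite integralD//; last exact: finite_measure_integrable_cst.
have P1 : (uniform_prob h [set: _] = 1)%E by exact: (@probability_setT _ _ _ (uniform_prob h)).
rewrite integral_cst// [X in (_ * X)%E]P1 mule1 => /(congr1 (fun y => y - K%:E)%E).
by rewrite subee// addeAC subee// add0e.
Qed.

End circle_integral.

(** * Integrals of characters over the torus *)

Section torus_integral.
Context {R : realType}.

Lemma measurable_Re_expi n (c : R[i]) (p : 'I_n -> R) :
  measurable_fun [set: n.-tuple (measurableTypeR R)]
    (fun t => Re (c * expi (\sum_i p i * tnth t i))).
Proof.
have mL : measurable_fun [set: n.-tuple (measurableTypeR R)]
    (fun t => (\sum_i p i * tnth t i) : R).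
  by apply: measurable_sum => i; apply: measurable_funM => //; exact: measurable_tnth.
have mR : measurable_fun [set: R] (fun x : R => Re (c * expi (1 * x))).
  by apply: continuous_measurable_fun; exact: continuous_Re_expi.
rewrite (_ : (fun t => _) = (fun x : R => Re (c * expi (1 * x))) \o
   (fun t : n.-tuple (measurableTypeR R) => (\sum_i p i * tnth t i) : R)).
  exact: measurableT_comp.
by apply/funext => t /=; rewrite mul1r.
Qed.

Lemma normr_Re_expi (c : R[i]) (x : R) : `|Re (c * expi x)| <= normc c.
Proof. by rewrite (le_trans (normc_Re _))// normcM normc_expi mulr1. Qed.

(** Induction on [n] by Fubini: the factor [expi (p ord0 * x)] of the first angle is absorbed into
    [c] for the inner integral. Integrands stay real; varying [c] recovers the complex integral. *)
Lemma integral_torus_expi n (c : R[i]) (p : 'I_n -> R) :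
  (forall i, expi (p i * (2 * pi)) = 1) ->
  (\int[torus_prob n]_t (Re (c * expi (\sum_i p i * tnth t i)))%:E =
    (if [forall i, p i == 0] then Re c else 0)%:E)%E.
Proof.
elim: n c p => [|n IH] c p hp.
  rewrite /= integral_dirac//; last first.
    by apply/measurable_EFinP; exact: measurable_Re_expi.
  rewrite diracT mul1e big_ord0 expi0 mulr1.
  by case: ifP => // /forallP [] [].
pose f (t : n.+1.-tuple (measurableTypeR R)) := Re (c * expi (\sum_i p i * tnth t i)).
have mf : measurable_fun setT f by exact: measurable_Re_expi.
have mg : measurable_fun setT (f \o @cons_pair R n).
  by apply: measurableT_comp => //; exact: measurable_cons_pair.
have bd t : `|f t| <= normc c by exact: normr_Re_expi.
have bg x : `|(f \o @cons_pair R n) x| <= normc c by exact: bd.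
have ig := prob_bounded_integrable
  (uniform_prob (@Defs.lt0_2pi_subproof R) \x torus_prob n)%E mg bg.
rewrite /= integral_distribution; last 2 first.
- exact/measurable_EFinP.
- exact: ig.
rewrite -(integral12_prod_meas1 ig) /fubini_F /=.
pose q i := p (lift ord0 i).
have E x t : f (cons_pair (x, t)) = Re (c * expi (p ord0 * x) * expi (\sum_i q i * tnth t i)).
  rewrite -mulrA -expiD /f big_ord_recl /=; congr (Re (_ * expi (_ + _))).
  by apply: eq_bigr => i _; rewrite tnthS.
under eq_integral => x _.
  under eq_integral => t _ do rewrite E.
  rewrite IH; last by move=> i; exact: hp.
  over.
have [q0|q0] := boolP [forall i, q i == 0]; last first.
  rewrite integral0; case: ifPn => // /forallP h; case/negP: q0.
  by apply/forallP => i; exact: h.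
have [p0|p0] := eqVneq (p ord0) 0.
  rewrite (_ : [forall i, p i == 0]); last first.
    apply/forallP => i; case: (unliftP ord0 i) => [j ->|->]; last by rewrite p0.
    exact: (forallP q0).
  under eq_integral do rewrite p0 mul0r expi0 mulr1.
  have P1 : (uniform_prob (@Defs.lt0_2pi_subproof R) [set: _] = 1)%E.
    exact: (@probability_setT _ _ _ (uniform_prob (@Defs.lt0_2pi_subproof R))).
  by rewrite integral_cst// [X in (_ * X)%E]P1 mule1.
rewrite integral_uniform_expi//; case: ifPn => // /forallP /(_ ord0).
by rewrite (negPf p0).
Qed.

End torus_integral.

(** * Orthogonality of characters and Parseval's identity *)

Section parseval.
Context {R : realType} {n : nat}.
Implicit Types (k l : mi n) (c d : mi n -> R[i]) (z s u : R[i]) (t : n.-tuple (measurableTypeR R)).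
Local Notation mu := (torus_prob n : probability (n.-tuple (measurableTypeR R)) R).

Definition chr k t : R[i] := monomial k (torus_point t).

Lemma normc_chr k t : normc (chr k t) = 1.
Proof.
rewrite (@normc_monomial_eq _ _ _ _ 1) ?expr1n// => i.
by rewrite mxE normc_expi.
Qed.

Lemma chrM_conj k l t :
  chr k t * (chr l t)^* = expi (\sum_i ((k i)%:R - (l i)%:R) * tnth t i).
Proof.
rewrite (big_morph _ (@expiD R) (@expi0 R)) rmorph_prod -big_split.
apply: eq_bigr => i _; rewrite mxE !expiX /= expi_conj -expiD.
by rewrite mulrBl.
Qed.

Lemma integral_chrM_conj z k l :
  (\int[mu]_t (Re (z * (chr k t * (chr l t)^*)))%:E
   = (if k == l then Re z else 0)%:E)%E.
Proof.
under eq_integral do rewrite chrM_conj.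
rewrite integral_torus_expi => [|i].
  congr ((if _ then _ else _)%:E); apply/forallP/eqP => [h|-> i]; last by rewrite subrr.
  by apply/ffunP => i; have := h i; rewrite subr_eq0 eqr_nat => /eqP.
have e2 j : expi (j%:R * (2 * pi)) = 1 :> R[i].
  by rewrite -expiX mulr_natl /expi cos2pi sin2pi expr1n.
by rewrite mulrBl expiD -expi_conj !e2 rmorph1 mulr1.
Qed.

Lemma Re_sum (T : Type) (r : seq T) (F : T -> R[i]) :
  Re (\sum_(i <- r) F i) = \sum_(i <- r) Re (F i).
Proof.
have ReD : {morph @complex.Re R : x y / x + y} by move=> [? ?] [? ?].
exact: (big_morph _ ReD erefl).
Qed.

Let trig (A : {fset mi n}) c t := \sum_(k <- A) c k * chr k t.

Let Re_trigM z A c d t : Re (z * (trig A c t * (trig A d t)^*)) =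
  \sum_(k <- A) \sum_(l <- A) Re (z * (c k * (d l)^*) * (chr k t * (chr l t)^*)).
Proof.
rewrite rmorph_sum mulr_suml mulr_sumr Re_sum; apply: eq_bigr => k _.
rewrite mulr_sumr mulr_sumr Re_sum; apply: eq_bigr => l _.
by rewrite rmorphM /=; congr (Re _); ring.
Qed.

Let measurable_term z k l :
  measurable_fun setT (fun t => Re (z * (chr k t * (chr l t)^*))).
Proof. by under eq_fun do rewrite chrM_conj; exact: measurable_Re_expi. Qed.

Let measurable_trigM z A c d :
  measurable_fun setT (fun t => Re (z * (trig A c t * (trig A d t)^*))).
Proof.
under eq_fun do rewrite Re_trigM.
by apply: measurable_sum => k; apply: measurable_sum => l; exact: measurable_term.
Qed.

Let integrable_term z k l :
  mu.-integrable setT (fun t => (Re (z * (chr k t * (chr l t)^*)))%:E).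
Proof.
apply: (prob_bounded_integrable mu (measurable_term z k l) (K := normc z)) => t.
by rewrite (le_trans (normc_Re _))// !normcM normc_conj !normc_chr !mulr1.
Qed.

Let integral_trigM z A c d :
  (\int[mu]_t (Re (z * (trig A c t * (trig A d t)^*)))%:E
  = (Re (z * \sum_(k <- A) c k * (d k)^*))%:E)%E.
Proof.
under eq_integral => t _.
  rewrite Re_trigM -sumEFin.
  under eq_bigr do rewrite -sumEFin.
  over.
rewrite integral_sum//; last first.
  by move=> k; apply: integrable_sum => // l _; exact: integrable_term.
rewrite mulr_sumr Re_sum -sumEFin big_seq [RHS]big_seq; apply: eq_bigr => k kA.
rewrite integral_sum//.
under eq_bigr do rewrite integral_chrM_conj.
rewrite (big_fsetD1 k)//= eqxx big_seq big1 ?adde0// => l.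
by rewrite !inE eq_sym => /andP[/negPf ->].
Qed.

Let cvg_part (f : R[i] -> R) (a : mi n -> R[i]) s : {morph f : x y / x - y} ->
  (forall x, `|f x| <= normc x) -> has_sum a s ->
  f (\sum_(k <- box N) a k) @[N --> \oo] --> f s.
Proof.
move=> fB hf h; apply/cvgrPdist_lt => e e0; have [N0 hN] := has_sum_box h e0.
exists N0 => // N /= /hN hs; rewrite -fB (le_lt_trans (hf _))//.
by rewrite normcB.
Qed.

Let ReB : {morph @complex.Re R : x y / x - y}. Proof. by move=> [? ?] [? ?]. Qed.
Let ImB : {morph @complex.Im R : x y / x - y}. Proof. by move=> [? ?] [? ?]. Qed.

Let ReM x y : Re (x * y) = Re x * Re y - Im x * Im y :> R. Proof. by case: x y => ? ? []. Qed.

Let Re_mulC z u s : Re (z * (u * s^*)) =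
  Re z * (Re u * Re s + Im u * Im s) - Im z * (Im u * Re s - Re u * Im s).
Proof.
case: z u s => ? ? [? ?] [? ?] /=; ring.
Qed.

(** For truncations to boxes this is orthogonality of the characters. The truncated integrands are
    bounded by [normc z * (M * N)], so dominated convergence passes to the limit. The free
    multiplier [z] encodes a complex identity by real integrals. *)
Lemma parseval z c d (F G : n.-tuple (measurableTypeR R) -> R[i]) s M N :
  bsum (normc \o c) M -> bsum (normc \o d) N ->
  (forall t, has_sum (fun k => c k * chr k t) (F t)) ->
  (forall t, has_sum (fun k => d k * chr k t) (G t)) ->
  has_sum (fun k => c k * (d k)^*) s ->
  measurable_fun setT (fun t => Re (z * (F t * (G t)^*))) /\
  (\int[mu]_t (Re (z * (F t * (G t)^*)))%:E = (Re (z * s))%:E)%E.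
Proof.
move=> hM hN hF hG hs.
pose f_ m t := Re (z * (trig (box m) c t * (trig (box m) d t)^*)).
have ff t : f_ ^~ t @ \oo --> Re (z * (F t * (G t)^*)).
  rewrite Re_mulC; under eq_fun do rewrite /f_ Re_mulC.
  have [FR FI] := (cvg_part ReB (@normc_Re R) (hF t), cvg_part ImB (@normc_Im R) (hF t)).
  have [GR GI] := (cvg_part ReB (@normc_Re R) (hG t), cvg_part ImB (@normc_Im R) (hG t)).
  by apply: cvgB; apply: cvgMr; [apply: cvgD|apply: cvgB]; apply: cvgM.
have mf : measurable_fun setT (fun t => Re (z * (F t * (G t)^*))).
  by apply: (@measurable_fun_cvg _ _ _ _ f_) => [m|t _]; [exact: measurable_trigM|exact: ff].
split => //.
have bt A (e : mi n -> R[i]) K t : bsum (normc \o e) K -> normc (trig A e t) <= K.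
  move=> hK; rewrite (le_trans (normc_sum _ _ _))// (le_trans _ (hK A))// ler_sum// => k _.
  by rewrite normcM normc_chr mulr1.
have fK m t : `|f_ m t| <= normc z * (M * N).
  rewrite (le_trans (normc_Re _))// !normcM normc_conj ler_wpM2l ?normc_ge0//.
  by rewrite ler_pM ?normc_ge0// bt.
have h : (fun m => \int[mu]_t (f_ m t)%:E)%E @ \oo -->
    (\int[mu]_t (Re (z * (F t * (G t)^*)))%:E)%E.
  by apply: (prob_bounded_cvg _ mf fK (aeW _ ff)) => m; exact: measurable_trigM.
have E m : (\int[mu]_t (f_ m t)%:E = (Re (z * \sum_(k <- box m) c k * (d k)^*))%:E)%E.
  exact: integral_trigM.
rewrite (funext E) in h; apply: cvg_unique h _ => //.
apply: cvg_EFin; first exact: nearW.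
rewrite /= /comp /=; under eq_fun do rewrite ReM; rewrite ReM.
by apply: cvgB; apply: cvgMr; [exact: (cvg_part ReB (@normc_Re R) hs)|exact: (cvg_part ImB (@normc_Im R) hs)].
Qed.

End parseval.

(** * Power series expansions and Cauchy's estimates *)

Section expansions.
Context {R : realType} {n : nat}.
Implicit Types (k j : mi n) (z w h v : 'rV[R[i]]_n) (a b : mi n -> R[i]) (f g : 'rV[R[i]]_n -> R[i]).
Implicit Types (r d e M rho delta : R).
Local Notation mu := (torus_prob n : probability (n.-tuple (measurableTypeR R)) R).

(** Finitely many strict inequalities share a margin; the maximum starts from [0], which covers
    [n = 0]. *)
Lemma normc_row_lt v e : 0 < e -> (forall i, normc (v ord0 i) < e) ->
  exists2 r, 0 <= r < e & forall i, normc (v ord0 i) <= r.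
Proof.
move=> e0 h; exists (\big[Num.max/0]_i normc (v ord0 i)).
  by rewrite bigmax_ge_id bigmax_lt.
by move=> i; apply: (le_bigmax _ (fun i => normc (v ord0 i))).
Qed.

Lemma has_sum_ge (I : choiceType) (x : I -> R) (s : R[i]) : (forall i, 0 <= x i) ->
  has_sum (fun i => (x i)%:C) s -> bsum x (Re s).
Proof.
move=> x0 /has_sumP hs B; apply/ler_addgt0Pr => e /hs[A hA].
apply: le_trans (ler_sum_fset x0 (fsubsetUl B A)) _.
have := hA _ (fsubsetUr B A); rewrite -rmorph_sum /=.
set S := \sum_(_ <- _) _ => h.
have : `|Re (S%:C - s)| < e by exact: le_lt_trans (normc_Re _) h.
by case: s {hs hA h} => u v /=; rewrite ltr_norml => /andP[_]; lra.
Qed.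

Lemma monomial_torus k r (t : n.-tuple (measurableTypeR R)) :
  monomial k (r%:C *: torus_point t) = (r ^+ mdeg k)%:C * chr k t.
Proof. by rewrite monomialZ rmorphXn. Qed.

(** By Parseval the sum of squares is the mean of [normc (G t) ^+ 2] over the torus of radius
    [rho]. *)
Lemma cauchy_l2 a (G : n.-tuple (measurableTypeR R) -> R[i]) rho B M :
  0 <= rho -> bsum (fun k => normc (a k) * rho ^+ mdeg k) B ->
  (forall t, has_sum (fun k => a k * monomial k (rho%:C *: torus_point t)) (G t)) ->
  (forall t, normc (G t) <= M) ->
  bsum (fun k => (normc (a k) * rho ^+ mdeg k) ^+ 2) (M ^+ 2).
Proof.
move=> rho0 hB hG GM; pose c k := a k * (rho ^+ mdeg k)%:C.
have nc k : normc (c k) = normc (a k) * rho ^+ mdeg k.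
  by rewrite normcM normcR ger0_norm ?exprn_ge0.
have hc : bsum (normc \o c) B by apply: bsum_le hB => // k /=; rewrite nc.
have hF t : has_sum (fun k => c k * chr k t) (G t).
  by apply: eq_has_sum (hG t) => k; rewrite monomial_torus mulrA.
have [s hs] : exists s, has_sum (fun k => c k * (c k)^*) s.
  apply: (@bsum_has_sum _ _ _ (B * B)) => /=.
  apply: bsum_le (bsumZ (bsum_ge0 hc) hc) => // k /=.
  by rewrite normcM normc_conj ler_wpM2r ?normc_ge0//; exact: bsum1 hc.
have [mF intF] := parseval 1 hc hc hF hF hs.
have hs2 : bsum (fun k => (normc (a k) * rho ^+ mdeg k) ^+ 2) (Re s).
  apply: has_sum_ge => [k|]; first exact: sqr_ge0.
  by apply: eq_has_sum hs => k; rewrite mulc_conj nc.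
apply: bsum_le hs2 => //; rewrite -[s]mul1r -lee_fin -intF.
have P1 : (mu [set: _] = 1)%E by exact: (@probability_setT _ _ _ mu).
have <- : (\int[mu]_t (M ^+ 2)%:E = (M ^+ 2)%:E)%E.
  by rewrite integral_cst// [X in (_ * X)%E]P1 mule1.
have E t : Re (1 * (G t * (G t)^*)) = normc (G t) ^+ 2 by rewrite mul1r mulc_conj.
apply: ge0_le_integral => //.
- by move=> t _; rewrite lee_fin E sqr_ge0.
- by apply/measurable_EFinP.
- by move=> t _; rewrite lee_fin E lerXn2r ?nnegrE ?normc_ge0// (le_trans _ (GM t)) ?normc_ge0.
Qed.

Lemma cauchy_estimate a (G : n.-tuple (measurableTypeR R) -> R[i]) rho B M :
  0 <= rho -> bsum (fun k => normc (a k) * rho ^+ mdeg k) B ->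
  (forall t, has_sum (fun k => a k * monomial k (rho%:C *: torus_point t)) (G t)) ->
  (forall t, normc (G t) <= M) ->
  forall k, normc (a k) * rho ^+ mdeg k <= M.
Proof.
move=> rho0 hB hG GM k; have M0 : 0 <= M by rewrite (le_trans _ (GM [tuple 0 | i < n])) ?normc_ge0.
have := bsum1 k (cauchy_l2 rho0 hB hG GM).
by rewrite ler_pXn2r ?nnegrE// mulr_ge0 ?normc_ge0 ?exprn_ge0.
Qed.

Definition expands f z e a := forall w, (forall i, normc (w ord0 i - z ord0 i) < e) ->
  has_sum (fun k => a k * monomial k (w - z)) (f w).

Lemma has_sum_bsum_const a r s : 0 <= r ->
  has_sum (fun k => a k * monomial k (const_mx r%:C)) s ->
  exists B, bsum (fun k => normc (a k) * r ^+ mdeg k) B.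
Proof.
move=> r0 /has_sum_bsum[B hB]; exists B; apply: bsum_le hB => // k /=.
by rewrite monomial_const normcM normcR ger0_norm ?exprn_ge0.
Qed.

Lemma expands_bsum f z e a r : expands f z e a -> 0 <= r < e ->
  exists B, bsum (fun k => normc (a k) * r ^+ mdeg k) B.
Proof.
move=> h /andP[r0 re]; apply: (has_sum_bsum_const (s := f (const_mx r%:C + z)) r0).
have := h (const_mx r%:C + z); rewrite addrK; apply => i.
by rewrite !mxE addrK normcR ger0_norm.
Qed.

Lemma expands_cauchy f z e a rho M : expands f z e a -> 0 <= rho < e ->
  (forall w, (forall i, normc (w ord0 i - z ord0 i) < e) -> normc (f w) <= M) ->
  forall k, normc (a k) * rho ^+ mdeg k <= M.
Proof.
move=> h /andP[r0 re] fM.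
have [B hB] := expands_bsum h (introT andP (conj r0 re)).
pose G t := f (rho%:C *: torus_point t + z).
have lt t i : normc ((rho%:C *: torus_point t + z) ord0 i - z ord0 i) < e.
  by rewrite !mxE addrK normcM normc_expi mulr1 normcR ger0_norm.
apply: (cauchy_estimate (G := G)) r0 hB _ _ => t; last exact/fM/lt.
by have := h _ (lt t); rewrite addrK.
Qed.

Lemma expands_le f z e d a : d <= e -> expands f z e a -> expands f z d a.
Proof. by move=> de h w wd; apply: h => i; exact: lt_le_trans (wd i) de. Qed.

(** Cauchy's estimate with bound [0] at radius [e / 2] kills the coefficients of the difference. *)
Lemma expands_uniq f g z e a b : 0 < e -> expands f z e a -> expands g z e b ->
  (forall w, (forall i, normc (w ord0 i - z ord0 i) < e) -> f w = g w) -> a = b.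
Proof.
move=> e0 ha hb fg; apply/funext => k; apply/eqP; rewrite -subr_eq0; apply/eqP.
have hab : expands (fun w => f w - g w) z e (fun k => a k - b k).
  move=> w hw; apply: eq_has_sum (has_sumB (ha w hw) (hb w hw)) => l.
  by rewrite mulrBl.
have e2 : 0 < e / 2 by rewrite divr_gt0.
have := @expands_cauchy _ _ _ _ (e / 2) 0 hab.
rewrite (ltW e2) ltr_pdivrMr// ltr_pMr// ltr1n.
move=> /(_ isT) /(_ (fun w hw => ltac:(by rewrite fg// subrr normc0))) /(_ k).
rewrite pmulr_lle0 ?exprn_gt0// => h; apply: eq0_normc; apply/le_anti.
by rewrite h normc_ge0.
Qed.

End expansions.

(** * Re-expansion of a power series at another centre *)

Section recentering.
Context {R : realType} {n : nat}.
Implicit Types (k j : mi n) (z w h v : 'rV[R[i]]_n) (a b : mi n -> R[i]) (f g : 'rV[R[i]]_n -> R[i]).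
Implicit Types (r d e M B rho delta : R).

(** The terms of the double series obtained by expanding each [a k * monomial k (h + v)]; [rfamily]
    is a majorant when the coordinates of [h] and [v] are bounded by [d] and [r]. *)
Let family a h v (p : mi n * mi n) : R[i] :=
  a p.1 * ((mbin p.1 p.2)%:R * monomial (msub p.1 p.2) h * monomial p.2 v).

Let rfamily a d r (p : mi n * mi n) : R :=
  normc (a p.1) * ((mbin p.1 p.2)%:R * d ^+ mdeg (msub p.1 p.2) * r ^+ mdeg p.2).

Lemma monomial_msub k j z : mle j k ->
  monomial j z * monomial (msub k j) z = monomial k z.
Proof. by move=> jk; rewrite -monomialD msubK. Qed.

Lemma real_multibinomial N k d r : k \in box N ->
  \sum_(j <- box N) (mbin k j)%:R * d ^+ mdeg (msub k j) * r ^+ mdeg j = (d + r) ^+ mdeg k.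
Proof.
move=> kN; apply: complexI.
have -> : ((d + r) ^+ mdeg k)%:C = monomial k (const_mx d%:C + const_mx r%:C : 'rV[R[i]]_n).
  rewrite -monomial_const; congr (monomial k _); apply/rowP => i.
  by rewrite !mxE rmorphD.
rewrite -(multibinomial _ _ kN) rmorph_sum; apply: eq_bigr => j _.
by rewrite !monomial_const !rmorphM rmorph_nat.
Qed.

Let bsum_rfamily a d r B : 0 <= d -> 0 <= r ->
  bsum (fun k => normc (a k) * (d + r) ^+ mdeg k) B -> bsum (rfamily a d r) B.
Proof.
move=> d0 r0 hB; apply: bsum_pair hB _ => [[k j]|k].
  by rewrite /rfamily !mulr_ge0 ?normc_ge0 ?exprn_ge0.
rewrite /rfamily /=; apply: bsumZ (normc_ge0 _) _.
have t0 j : 0 <= (mbin k j)%:R * d ^+ mdeg (msub k j) * r ^+ mdeg j.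
  by rewrite !mulr_ge0 ?exprn_ge0.
apply: bsum_box => // N; have [N' kN'] := box_cofinal [fset k]%fset.
have kM : k \in box (maxn N N').
  by apply: (fsubsetP (box_sub (leq_maxr N N'))); rewrite (fsubsetP kN')// inE.
by rewrite -(real_multibinomial _ _ kM) ler_sum_fset// box_sub// leq_maxl.
Qed.

Let normc_nat (m : nat) : normc (m%:R : R[i]) = m%:R.
Proof.
have -> : m%:R = (m%:R)%:C :> R[i] by rewrite rmorph_nat.
by rewrite normcR ger0_norm.
Qed.

Let normc_family a h v d r p : (forall i, normc (h ord0 i) <= d) ->
  (forall i, normc (v ord0 i) <= r) -> normc (family a h v p) <= rfamily a d r p.
Proof.
move=> hd vr; rewrite /family /rfamily !normcM normc_nat ler_wpM2l ?normc_ge0//.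
by rewrite ler_pM ?mulr_ge0 ?normc_ge0// ?ler_wpM2l// normc_monomial.
Qed.

(** The Taylor coefficient [D^j f(h) / j!] of the sum [f] of the series [a]. *)
Definition recenter a h j : R[i] :=
  usum (fun k => (mbin k j)%:R * a k * monomial (msub k j) h).

Lemma has_sum_recenter a h d r B j : 0 <= d -> 0 < r ->
  bsum (fun k => normc (a k) * (d + r) ^+ mdeg k) B ->
  (forall i, normc (h ord0 i) <= d) ->
  has_sum (fun k => (mbin k j)%:R * a k * monomial (msub k j) h) (recenter a h j).
Proof.
move=> d0 r0 hB hd.
pose v : 'rV[R[i]]_n := const_mx r%:C.
have vr i : normc (v ord0 i) <= r by rewrite mxE normcR ger0_norm// ltW.
have hb := bsum_rfamily d0 (ltW r0) hB.
have rj : r ^+ mdeg j != 0 by rewrite expf_neq0// gt_eqF.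
suff [s hs] : exists s, has_sum (fun k => (mbin k j)%:R * a k * monomial (msub k j) h) s.
  by rewrite /recenter (usumE hs).
apply: (@bsum_has_sum _ _ _ ((r ^+ mdeg j)^-1 * B)) => A.
rewrite ler_pdivlMl ?exprn_gt0//.
apply: le_trans (hb [fset (k, j) | k in A]%fset).
rewrite big_imfset /=; last by move=> k l _ _ [].
rewrite mulr_sumr ler_sum// => k _; apply: le_trans (normc_family a (k, j) hd vr).
rewrite /family /= monomial_const !normcM [normc _%:C]normcR ger0_norm ?exprn_ge0 ?(ltW r0)//.
by rewrite le_eqVlt; apply/orP; left; apply/eqP; ring.
Qed.

(** The double series [family] converges absolutely. Summed over [j] first it gives the expansion at
    [z], over [k] first the one at [z']. *)
Lemma expands_recenter f z z' e d a : 0 <= d < e -> expands f z e a ->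
  (forall i, normc (z' ord0 i - z ord0 i) <= d) ->
  expands f z' (e - d) (recenter a (z' - z)).
Proof.
move=> /andP[d0 de] ha zd w wz'.
have ed0 : 0 < e - d by rewrite subr_gt0.
set h := z' - z; set v := w - z'.
have hd i : normc (h ord0 i) <= d by rewrite !mxE.
have [|r0 /andP[r00 r0e] vr0] := @normc_row_lt _ _ v _ ed0.
  by move=> i; rewrite !mxE.
(* The midpoint is positive even if [v = 0], and still satisfies [d + r < e]. *)
pose r := (r0 + (e - d)) / 2.
have r_gt0 : 0 < r by rewrite divr_gt0// ltr_wpDl.
have vr i : normc (v ord0 i) <= r.
  by rewrite (le_trans (vr0 i))// /r; lra.
have dr : 0 <= d + r < e by rewrite addr_ge0 ?(ltW r_gt0)//= /r; lra.
have [B hB] := expands_bsum ha dr.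
have hb := bsum_rfamily d0 (ltW r_gt0) hB.
have [s hs] : exists s, has_sum (family a h v) s.
  apply: (@bsum_has_sum _ _ _ B); apply: bsum_le hb => // p /=.
  exact: normc_family.
have hf : has_sum (fun k => a k * monomial k (h + v)) s.
  apply: has_sum_fst hs _ => k; have [N kN] := box_cofinal [fset k]%fset.
  have {}kN : k \in box N by rewrite (fsubsetP kN)// inE.
  rewrite -(multibinomial h v kN) mulr_sumr.
  apply: (@has_sum_fin _ _ (box N) (fun j => family a h v (k, j))) => j jN.
  rewrite /family /= mbin_eq0 ?mul0r ?mulr0//.
  apply: contra jN; rewrite !mem_box in kN * => /forallP jk.
  by apply/forallP => i; exact: leq_ltn_trans (jk i) (forallP kN i).
have -> : f w = s.
  apply: has_sum_unique hf.
  have := ha w; rewrite (_ : w - z = h + v); last by apply/rowP => i; rewrite !mxE; ring.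
  apply => i; rewrite (_ : _ - _ = h ord0 i + v ord0 i); last by rewrite !mxE; ring.
  rewrite (le_lt_trans (le_normcD _ _))// -[e](subrKC d).
  by rewrite ler_ltD// !mxE.
apply: has_sum_snd hs _ => j.
have := has_sumZ (c := monomial j v) (has_sum_recenter (j := j) d0 r_gt0 hB hd).
by rewrite mulrC; apply: eq_has_sum => k; rewrite /family /=; ring.
Qed.

(** The sum of [2^-|j|] over all multi-indices [j]. *)
Let bound2 : R := (1 - 2^-1)^-1 ^+ n.

(* Cauchy's estimates for the expansions of [f] at the points [z] with
   [|z_i| = rho] bound the power series
   [sum_k mbin k j * a k * z^k = z^j * recenter a z j] in terms of [delta];
   summing over [j] recovers [a k * (rho + delta / 2) ^ |k|]. *)
Lemma expands_coef_bound f r a rho delta M : 0 < rho < r -> 0 < delta ->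
  expands f 0 r a ->
  (forall z, (forall i, normc (z ord0 i) = rho) -> exists c, expands f z (2 * delta) c) ->
  (forall w, (forall i, normc (w ord0 i) < rho + 2 * delta) -> normc (f w) <= M) ->
  forall k, normc (a k) * (rho + delta / 2) ^+ mdeg k <= M * bound2.
Proof.
move=> /andP[rho0 rhor] delta0 ha hc fM k.
have M0 : 0 <= M.
  apply: le_trans (fM 0 _); rewrite ?normc_ge0// => i.
  by rewrite mxE normc0 addr_gt0// mulr_gt0.
have rr : 0 < (r - rho) / 2 by rewrite divr_gt0// subr_gt0.
have rlt : 0 <= rho + (r - rho) / 2 < r by apply/andP; split; lra.
have [B hB] := expands_bsum ha rlt.
have coef j : (mbin k j)%:R * normc (a k) * rho ^+ mdeg k <= M * (rho / delta) ^+ mdeg j.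
  pose G (t : n.-tuple (measurableTypeR R)) :=
    monomial j (rho%:C *: torus_point t) * recenter a (rho%:C *: torus_point t) j.
  have zr (t : n.-tuple (measurableTypeR R)) i :
      normc ((rho%:C *: torus_point t : 'rV[R[i]]_n) ord0 i) = rho.
    by rewrite !mxE normcM normc_expi mulr1 normcR ger0_norm// ltW.
  have hG t : has_sum (fun k => (mbin k j)%:R * a k * monomial k (rho%:C *: torus_point t)) (G t).
    apply: eq_has_sum (has_sumZ (c := monomial j (rho%:C *: torus_point t))
      (has_sum_recenter (j := j) (ltW rho0) rr hB (fun i => _))) => [l|i]; last by rewrite zr.
    have [jl|jl] := boolP (mle j l); last by rewrite mbin_eq0// !mul0r mulr0.
    by rewrite -(monomial_msub _ jl); ring.
  have GM t : normc (G t) <= M * (rho / delta) ^+ mdeg j.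
    set z := rho%:C *: torus_point t.
    have [c hcz] := hc z (zr t).
    have hz : expands f z (r - rho) (recenter a z).
      have := @expands_recenter f 0 z r rho a; rewrite subr0; apply => //.
        by rewrite ltW.
      by move=> i; rewrite [X in _ - X]mxE subr0 (zr t i).
    have m0 : 0 < Num.min (r - rho) (2 * delta) by rewrite lt_min subr_gt0 rhor mulr_gt0.
    (* The recentred series is known to represent [f] only at distance less than [r - rho].
       Uniqueness identifies it with [c], valid up to [2 * delta], so Cauchy's estimate applies at
       radius [delta]. *)
    have E : recenter a z = c.
      apply: (expands_uniq m0) => [||w _ //].
        by apply: expands_le hz; rewrite ge_min lexx.
      by apply: expands_le hcz; rewrite ge_min lexx orbT.
    have cb := @expands_cauchy _ _ f z (2 * delta) c delta M hcz _ _ j.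
    rewrite /G -/z normcM (normc_monomial_eq _ (zr t)) E expr_div_n mulrCA ler_wpM2l ?exprn_ge0 ?(ltW rho0)//.
    rewrite ler_pdivlMr ?exprn_gt0//; apply: cb; first by rewrite ltW//=; lra.
    move=> w wz; apply: fM => i; rewrite -[w ord0 i](subrKC (z ord0 i)).
    by rewrite (le_lt_trans (le_normcD _ _))// zr ltrD2l.
  have hBj : exists B', bsum (fun k => normc ((mbin k j)%:R * a k) * rho ^+ mdeg k) B'.
    apply: (has_sum_bsum_const
      (s := monomial j (const_mx rho%:C) * recenter a (const_mx rho%:C) j) (ltW rho0)).
    apply: eq_has_sum (has_sumZ (c := monomial j (const_mx rho%:C))
      (has_sum_recenter (j := j) (ltW rho0) rr hB (fun i => _))) => [l|i]; last first.
      by rewrite mxE normcR ger0_norm// ltW.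
    have [jl|jl] := boolP (mle j l); last by rewrite mbin_eq0// !mul0r mulr0.
    by rewrite -(monomial_msub _ jl); ring.
  have [B' hB'] := hBj.
  have := cauchy_estimate (ltW rho0) hB' hG GM k.
  by rewrite normcM normc_nat.
have [N kN] := box_cofinal [fset k]%fset.
have {}kN : k \in box N by rewrite (fsubsetP kN)// inE.
(* The power of [rho + delta / 2] is expanded; by [coef j], its [j]-th term contributes at most
   [M * 2^-|j|]. *)
rewrite -(real_multibinomial _ _ kN) mulr_sumr.
have h2 : 0 <= (2^-1 : R) < 1 by rewrite invr_ge0 ler0n/= invf_lt1// ltr1n.
apply: le_trans (_ : M * \sum_(j <- box N) (2^-1) ^+ mdeg j <= _); last first.
  by apply: ler_wpM2l => //; exact: bsum_geo h2 _.
rewrite mulr_sumr ler_sum// => j _.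
have [jk|jk] := boolP (mle j k); last first.
  by rewrite mbin_eq0// !mul0r mulr0 mulr_ge0// exprn_ge0// invr_ge0.
have mk : mdeg k = (mdeg j + mdeg (msub k j))%N by rewrite -mdegD msubK.
have rj : 0 < rho ^+ mdeg j by rewrite exprn_gt0.
have dj : 0 < delta ^+ mdeg j by rewrite exprn_gt0.
have := coef j; rewrite mk exprD !expr_div_n exprVn [leRHS]mulrA ler_pdivlMr// => h.
have {}h : (mbin k j)%:R * normc (a k) * rho ^+ mdeg (msub k j) * delta ^+ mdeg j <= M.
  rewrite -(ler_pM2r rj); apply: le_trans h.
  by rewrite le_eqVlt; apply/orP; left; apply/eqP; ring.
apply: le_trans (ler_wpM2r _ h); last by rewrite invr_ge0 exprn_ge0.
by rewrite le_eqVlt; apply/orP; left; apply/eqP; ring.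
Qed.

End recentering.

(** * From local expansions to the whole polydisc *)

Section continuation.
Context {R : realType} {n : nat}.
Implicit Types (k j : mi n) (z w h v : 'rV[R[i]]_n) (a b : mi n -> R[i]) (f g : 'rV[R[i]]_n -> R[i]).
Implicit Types (r d e M B rho delta : R).

Lemma expands_near f z z' d e : 0 <= d -> 0 < e -> (exists a, expands f z (d + e) a) ->
  (forall i, normc (z' ord0 i - z ord0 i) <= d) -> exists b, expands f z' e b.
Proof.
move=> d0 e0 [a ha] hd; exists (recenter a (z' - z)).
rewrite -[e](addKr d) addrC; apply: expands_recenter ha hd.
by rewrite d0 ltrDl.
Qed.

(** Coding points by real and imaginary parts reduces compactness to that of a product of real
    cubes. *)
Let point (x : 'rV[R]_n * 'rV[R]_n) : 'rV[R[i]]_n := \row_i (x.1 ord0 i +i* x.2 ord0 i).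

Let cube r := [set x : 'rV[R]_n | forall i, `[(- r), r]%classic (x ord0 i)].

Let compact_square r : compact (cube r `*` cube r).
Proof.
have h : compact (cube r).
  apply: (@rV_compact _ n (fun=> `[(- r), r]%classic)) => _.
  exact: segment_compact.
exact: compact_setX.
Qed.

Let point_square z r : (forall i, normc (z ord0 i) <= r) ->
  exists2 x, (cube r `*` cube r) x & point x = z.
Proof.
move=> zr; exists (\row_i Re (z ord0 i), \row_i Im (z ord0 i)).
  by split => i; rewrite /= mxE in_itv /= -ler_norml (le_trans _ (zr i)) ?normc_Re ?normc_Im.
by apply/rowP => i; rewrite !mxE; case: (z _ _).
Qed.

Let point_near x y e : ball x (e / 2) y -> forall i, normc (point y ord0 i - point x ord0 i) <= e.
Proof.
move=> [[_ h1] [_ h2]] i; have {h1 h2}[/= h1 h2] := (h1 ord0 i, h2 ord0 i); rewrite !mxE.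
rewrite (le_trans (normc_le_ReIm _))// [e](splitr e) lerD// distrC.
  exact: ltW.
exact: ltW.
Qed.

Let sub_row0 w i : w ord0 i - (0 : 'rV[R[i]]_n) ord0 i = w ord0 i.
Proof. by rewrite [X in _ - X]mxE subr0. Qed.

(** Half of a radius valid at a point is valid at all points within that half. A point of the cube
    outside the closed polydisc has a neighbourhood outside it, where [P] holds vacuously.
    Compactness then gives one radius for all points. *)
Lemma uniform_radius f r :
  (forall z, (forall i, normc (z ord0 i) <= r) ->
     exists2 e, 0 < e & exists a, expands f z e a) ->
  exists2 e, 0 < e & forall z, (forall i, normc (z ord0 i) <= r) -> exists a, expands f z e a.
Proof.
move=> hf.
pose P e (x : 'rV[R]_n * 'rV[R]_n) := (forall i, normc (point x ord0 i) <= r) ->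
  exists a, expands f (point x) e a.
have /near_covering_withinP : near_covering (cube r `*` cube r).
  exact/compact_near_coveringP/compact_square.
move=> /(_ R (0 : R)^'+ P _) [].
  move=> x _.
  have [e e0 he] : exists2 e, 0 < e & forall y, 
     (forall i, normc (point y ord0 i - point x ord0 i) <= e / 2) -> P (e / 2) y.
    have [xr|/existsNP[i0 /negP]] := pselect (forall i, normc (point x ord0 i) <= r).
      have [e e0 ha] := hf _ xr; exists e => // y xy _.
      by apply: expands_near xy; rewrite ?divr_ge0 ?divr_gt0 ?(ltW e0)// -splitr.
    rewrite -ltNge => xr; exists (normc (point x ord0 i0) - r); first by rewrite subr_gt0.
    move=> y xy yr; exfalso; have := xy i0; have := yr i0.
    have := le_normcD (point y ord0 i0) (point x ord0 i0 - point y ord0 i0).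
    by rewrite subrKC normcB; lra.
  exists (ball x (e / 2 / 2), [set d | 0 < d <= e / 2]) => /=.
    split; first by apply: nbhsx_ballx; rewrite !divr_gt0.
    near=> d; apply/andP; split; near: d; first exact: nbhs_right_gt.
    by apply: nbhs_right_le; rewrite divr_gt0.
  move=> [y d] /= [yx /andP[d0 de]] _ yr.
  have [a ha] := he y (point_near yx) yr.
  by exists a; apply: expands_le ha.
move=> e e0 he; exists (e / 2); first by rewrite divr_gt0.
move=> z zr; have [x sx xz] := point_square zr.
have := he (e / 2) _ _ x sx; rewrite /P xz; apply => //=.
  by rewrite sub0r normrN gtr0_norm ?divr_gt0// ltr_pdivrMr// ltr_pMr// ltr1n.
by rewrite divr_gt0.
Unshelve. all: by end_near.
Qed.

(** By [expands_coef_bound] the series converges on a polydisc of radius [s > r], to a function [F].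
    At a point [w] there, [f] and [F] are compared through their common expansion at a multiple [z]
    of [w] that lies in the smaller polydisc. *)
Lemma expands_step f a r M : 0 < r < 1 ->
  (forall z, (forall i, normc (z ord0 i) < 1) -> exists2 e, 0 < e & exists a, expands f z e a) ->
  (forall z, (forall i, normc (z ord0 i) < 1) -> normc (f z) <= M) ->
  expands f 0 r a -> exists2 s, r < s & expands f 0 s a.
Proof.
move=> /andP[r0 r1] hf fM ha.
have [|d0 d00 hd0] := @uniform_radius f r.
  by move=> z zr; apply: hf => i; exact: le_lt_trans (zr i) r1.
(* With [rho = r - delta / 4], the three bounds on [2 * delta] give the expansions at radius
   [2 * delta], keep [rho + 2 * delta] below 1 and keep [rho] positive; moreover
   [rho + delta / 2 = s]. *)
pose delta := Num.min d0 (Num.min (1 - r) r) / 2.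
have delta0 : 0 < delta by rewrite divr_gt0// !lt_min d00 subr_gt0 r1.
have [dd0 dr1 drr] : [/\ 2 * delta <= d0, 2 * delta <= 1 - r & 2 * delta <= r].
  by rewrite mulrC divfK//; split; rewrite !ge_min lexx ?orbT.
pose s := r + delta / 4; exists s; first by rewrite ltrDl divr_gt0.
have rho_r : 0 < r - delta / 4 < r by apply/andP; split; lra.
have cb k : normc (a k) * s ^+ mdeg k <= M * (1 - 2^-1)^-1 ^+ n.
  have := @expands_coef_bound _ _ f r a (r - delta / 4) delta M rho_r delta0 ha _ _ k.
  have -> : r - delta / 4 + delta / 2 = s by rewrite /s; field.
  apply => [z zr|w wr].
    have [|c hc] := hd0 z; first by move=> i; rewrite zr; lra.
    by exists c; apply: expands_le hc.
  by apply: fM => i; apply: lt_le_trans (wr i) _; lra.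
pose F w := usum (fun k => a k * monomial k w).
have s0 : 0 < s by rewrite /s; lra.
have hF : expands F 0 s a.
  move=> w ws0; have {ws0} ws i : normc (w ord0 i) < s by have := ws0 i; rewrite sub_row0.
  rewrite subr0.
  have [q /andP[q0 qs] wq] := normc_row_lt s0 ws.
  have [B hB] := bsum_powers cb (introT andP (conj q0 qs)).
  have [u hu] : exists u, has_sum (fun k => a k * monomial k w) u.
    apply: (@bsum_has_sum _ _ _ B); apply: bsum_le hB => // k /=.
    by rewrite normcM ler_wpM2l ?normc_ge0// normc_monomial.
  by rewrite /F (usumE hu).
have fF w : (forall i, normc (w ord0 i) < r) -> f w = F w.
  move=> wr; have := ha w; rewrite subr0 => h; rewrite /F (usumE (h _))// => i.
  by rewrite sub_row0.
suff E w : (forall i, normc (w ord0 i) < s) -> f w = F w.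
  by move=> w ws; rewrite E; [exact: hF|move=> i; have := ws i; rewrite sub_row0].
move=> ws; have [q /andP[q0 qs] wq] := normc_row_lt s0 ws.
(* Scaling by [t] sends radius [s] to radius [r]. The distance from [w] to [t w] is less than both
   [s - t * q] and [s - r = delta / 4], so both expansions at [t w] are valid at [w]. *)
pose t := r / s; have ts : t * s = r by rewrite /t divfK// gt_eqF.
have t0 : 0 < t by rewrite divr_gt0.
have t1 : t < 1 by rewrite ltr_pdivrMr// mul1r /s; lra.
pose z := t%:C *: w.
have zq i : normc (z ord0 i) <= t * q.
  by rewrite mxE normcM normcR gtr0_norm// ler_wpM2l// ltW.
have tqr : t * q < r by rewrite -ts ltr_pM2l.
have wz i : normc (w ord0 i - z ord0 i) <= (1 - t) * q.
  rewrite mxE -[X in X - _]mul1r -mulrBl -(rmorph1 (real_complex R)) -rmorphB.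
  by rewrite normcM normcR gtr0_norm ?subr_gt0// ler_wpM2l// subr_ge0 ltW.
have [|c hc] := hd0 z; first by move=> i; rewrite (le_trans (zq i))// ltW.
have tq0 : 0 <= t * q by rewrite mulr_ge0// ltW.
have hb : expands F z (s - t * q) (recenter a z).
  have := @expands_recenter _ _ F 0 z s (t * q) a; rewrite subr0; apply => //.
    by rewrite tq0 (lt_trans tqr)// /s; lra.
  by move=> i; rewrite sub_row0.
have m0 : 0 < Num.min d0 (r - t * q) by rewrite lt_min d00 subr_gt0.
have E : c = recenter a z.
  apply: (expands_uniq m0) => [||u uz].
  - by apply: expands_le hc; rewrite ge_min lexx.
  - by apply: expands_le hb; rewrite ge_min lerD2r /s; apply/orP; right; lra.
  apply: fF => i; rewrite -[u ord0 i](subrKC (z ord0 i)) (le_lt_trans (le_normcD _ _))//.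
  rewrite -[ltRHS](subrKC (t * q)) ler_ltD//.
  by apply: lt_le_trans (uz i) _; rewrite ge_min lexx orbT.
have wz1 i : normc (w ord0 i - z ord0 i) < s - t * q.
  by apply: le_lt_trans (wz i) _; rewrite mulrBl mul1r ltrD2r.
have wz2 i : normc (w ord0 i - z ord0 i) < d0.
  apply: le_lt_trans (wz i) _; apply: (@le_lt_trans _ _ ((1 - t) * s)).
    by apply: ler_wpM2l; [rewrite subr_ge0 ltW|exact: ltW].
  by rewrite mulrBl mul1r ts /s; lra.
by apply: has_sum_unique (hb w wz1); rewrite -E; exact: hc.
Qed.

(** Let [s] be the supremum of the radii at most 1 on which the expansion at [0] is valid. It is
    attained, as every point of the open polydisc of radius [s] lies in a smaller admissible one;
    [s < 1] would contradict [expands_step]. *)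
Lemma expands_global f M :
  (forall z, (forall i, normc (z ord0 i) < 1) -> exists2 e, 0 < e & exists a, expands f z e a) ->
  (forall z, (forall i, normc (z ord0 i) < 1) -> normc (f z) <= M) ->
  exists a, expands f 0 1 a.
Proof.
move=> hf fM; have [|e e0 [a ha]] := hf 0; first by move=> i; rewrite mxE normc0.
exists a; pose E := [set r | [/\ 0 < r, r <= 1 & expands f 0 r a]].
have hE : has_sup E.
  split; last by exists 1 => r [].
  exists (Num.min e 1); split; rewrite ?lt_min ?e0 ?ltr01 ?ge_min ?lexx ?orbT//.
  by apply: expands_le ha; rewrite ge_min lexx.
set s := sup E.
have s0 : 0 < s.
  have [[r Er] _] := hE; have [r0 _ _] := Er; apply: lt_le_trans r0 _.
  by apply: ub_le_sup Er; case: hE.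
have s1 : s <= 1 by apply: ge_sup => [|r []//]; case: hE.
have hs : expands f 0 s a.
  move=> w ws; have [|q /andP[q0 qs] wq] := @normc_row_lt _ _ (w - 0) s s0.
    by move=> i; have := ws i; rewrite !mxE.
  have sq : 0 < s - q by rewrite subr_gt0.
  have [r [_ _ hr]] := sup_adherent sq hE; rewrite subKr => qr.
  apply: hr => i; have := wq i; rewrite mxE [X in _ + X]mxE => wqi.
  exact: le_lt_trans qr.
have [s_1|] := ltP s 1; last by move=> s_1; rewrite (_ : 1 = s)//; apply/le_anti; rewrite s_1.
have [|r sr hr] := @expands_step f a s M _ hf fM hs; first by rewrite s0.
have : Num.min r 1 <= s.
  apply: ub_le_sup; first by case: hE.
  split; rewrite ?lt_min ?ltr01 ?(lt_trans s0 sr) ?ge_min ?lexx ?orbT//.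
  by apply: expands_le hr; rewrite ge_min lexx.
by rewrite ge_min leNgt sr/= leNgt s_1.
Qed.

End continuation.

(** * Square-summable families and translates *)

Section dominated.
Context {R : realType} {I : choiceType}.

Lemma cvg_sumr (r : seq I) (u : I -> nat -> R) (l : I -> R) :
  (forall i, u i m @[m --> \oo] --> l i) ->
  (\sum_(i <- r) u i m) @[m --> \oo] --> \sum_(i <- r) l i.
Proof.
move=> h; elim: r => [|i r IH].
  by rewrite big_nil; under eq_fun do rewrite big_nil; exact: cvg_cst.
by rewrite big_cons; under eq_fun do rewrite big_cons; exact: cvgD.
Qed.

(** Choose a finite [A] off which [y] sums to less than [e / 4]. Terms in [A] converge one by one,
    and off [A] the differences are at most [y i + y i]. *)
Lemma has_sum_dominated (X : nat -> I -> R[i]) (Y : I -> R[i]) (y : I -> R) B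
    (s_ : nat -> R[i]) (s : R[i]) :
  bsum y B -> (forall m i, normc (X m i) <= y i) ->
  (forall i, normc (X m i - Y i) @[m --> \oo] --> (0 : R)) ->
  (forall m, has_sum (X m) (s_ m)) -> has_sum Y s ->
  normc (s_ m - s) @[m --> \oo] --> (0 : R).
Proof.
move=> hy Xy XY hX hY.
have y0 i : 0 <= y i by rewrite (le_trans _ (Xy 0%N i)) ?normc_ge0.
have Yy i : normc (Y i) <= y i.
  apply/ler_addgt0Pr => e e0; have /cvgrPdist_lt /(_ e e0)[N _ /(_ N (leqnn N))] := XY i.
  rewrite sub0r normrN ger0_norm ?normc_ge0// => h.
  rewrite -[Y i](subrKC (X N i)) (le_trans (le_normcD _ _))// lerD//.
  by rewrite normcB ltW.
apply/cvgrPdist_le => e e0; have e8 : 0 < e / 4 by rewrite divr_gt0.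
have [A hA] := bsum_tail y0 hy e8.
have S0 : (\sum_(i <- A) normc (X m i - Y i)) @[m --> \oo] --> (0 : R).
  have := cvg_sumr (r := enum_fset A) (u := fun i m => normc (X m i - Y i)) XY.
  by rewrite big1.
have /cvgrPdist_le /(_ _ (divr_gt0 e0 (ltr0n _ 2)))[N _ hN] := S0.
exists N => // m /= /hN h; rewrite sub0r normrN ger0_norm ?normc_ge0//.
rewrite sub0r normrN ger0_norm in h; last first.
  by apply: sumr_ge0 => i _; exact: normc_ge0.
apply: has_sum_le (has_sumB (hX m) hY) => D /=.
rewrite -(fsetID A D) sum_fsetU; last first.
  by move=> i; rewrite !inE => /andP[_ ->].
rewrite [e]splitr lerD//.
  by apply: le_trans h; apply: ler_sum_fset => [i|]; rewrite ?normc_ge0 ?fsubsetIr.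
have AD : {in (D `\` A)%fset, forall i, i \notin A} by move=> i; rewrite !inE => /andP[].
have -> : e / 2 = e / 4 + e / 4 by field.
apply: (@le_trans _ _ (\sum_(i <- (D `\` A)%fset) (y i + y i))).
  by apply: ler_sum => i _; rewrite (le_trans (le_normcD _ _))// normcN lerD.
by rewrite big_split /= lerD// ltW// hA.
Qed.

Lemma cauchy_schwarz_fset (A : {fset I}) (x y : I -> R) :
  (\sum_(i <- A) x i * y i) ^+ 2 <= (\sum_(i <- A) x i ^+ 2) * (\sum_(i <- A) y i ^+ 2).
Proof.
set a := \sum_(i <- A) x i ^+ 2; set b := \sum_(i <- A) x i * y i; set c := \sum_(i <- A) y i ^+ 2.
have q s t : 0 <= s ^+ 2 * a + 2 * s * t * b + t ^+ 2 * c.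
  rewrite /a /b /c !mulr_sumr -!big_split /= sumr_ge0// => i _.
  by rewrite (_ : _ + _ = (s * x i + t * y i) ^+ 2) ?sqr_ge0//; ring.
have a0 : 0 <= a by rewrite sumr_ge0// => i _; rewrite sqr_ge0.
(* If [a = 0], the chosen values of the form give [- (c + 2) * b ^+ 2 >= 0], hence [b = 0].
   Otherwise [q (- b) a] is [a * (a * c - b ^+ 2)]. *)
have [a_0|aN] := eqVneq a 0.
  have := q (- (c + 1)) b; have := q (c + 1) (- b); rewrite a_0.
  have c0 : 0 <= c by rewrite sumr_ge0// => i _; rewrite sqr_ge0.
  by nra.
have := q (- b) a; have a1 : 0 < a by rewrite lt_def aN.
rewrite (_ : _ + _ = a * (a * c - b ^+ 2)); last by ring.
by rewrite pmulr_rge0// subr_ge0.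
Qed.

Definition l2b (x : I -> R[i]) B := bsum (fun i => normc (x i) ^+ 2) B.

Lemma l2b_mul x y B D : l2b x B -> l2b y D ->
  bsum (fun i => normc (x i) * normc (y i)) (Num.sqrt (B * D)).
Proof.
move=> hx hy A; rewrite -[leLHS]ger0_norm; last first.
  by rewrite sumr_ge0// => i _; rewrite mulr_ge0 ?normc_ge0.
rewrite -sqrtr_sqr ler_sqrt ?mulr_ge0 ?(bsum_ge0 hx) ?(bsum_ge0 hy)//.
rewrite (le_trans (cauchy_schwarz_fset _ _ _))//.
by rewrite ler_pM ?sumr_ge0// => i _; rewrite sqr_ge0.
Qed.

Lemma l2b_ip x y B D : l2b x B -> l2b y D -> exists s, has_sum (fun i => x i * (y i)^*) s.
Proof.
move=> hx hy; apply: (@bsum_has_sum _ _ _ (Num.sqrt (B * D))).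
by apply: bsum_le (l2b_mul hx hy) => // i /=; rewrite normcM normc_conj.
Qed.

Lemma l2b_ip_le x y B D s : l2b x B -> l2b y D -> has_sum (fun i => x i * (y i)^*) s ->
  normc s <= Num.sqrt (B * D).
Proof.
move=> hx hy; apply: has_sum_le.
by apply: bsum_le (l2b_mul hx hy) => // i /=; rewrite normcM normc_conj.
Qed.

End dominated.

(** * Translates of families indexed by multi-indices *)

Section shifts.
Context {R : realType} {n : nat}.
Implicit Types (c d k j : mi n) (x y : mi n -> R[i]).

(** Multiplication by the monomial [z^c], on coefficients. *)
Definition mshift c x : mi n -> R[i] := fun k => if mle c k then x (msub k c) else 0.

Lemma mshift_madd c x j : mshift c x (madd c j) = x j.
Proof. by rewrite /mshift mle_add maddK. Qed.

Lemma has_sum_madd c (g : mi n -> R[i]) s : (forall k, ~~ mle c k -> g k = 0) ->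
  has_sum (fun j => g (madd c j)) s -> has_sum g s.
Proof.
move=> g0; apply: has_sum_inj => [|//|k hk]; first exact: maddI.
by apply: g0; apply/negP => /mle_addP[j kj]; apply: (hk j).
Qed.

Lemma mshift0 x : mshift mi0 x = x.
Proof. by apply/funext => k; rewrite -{1}[k]madd0 maddC mshift_madd. Qed.

Lemma mshiftD c d x : mshift c (mshift d x) = mshift (madd c d) x.
Proof.
apply/funext => k; have [/mle_addP[j ->]|ck] := boolP (mle c k).
  rewrite mshift_madd; have [/mle_addP[l ->]|dj] := boolP (mle d j).
    by rewrite maddA !mshift_madd.
  by rewrite /mshift (negPf dj) mle_add2l (negPf dj).
rewrite /mshift (negPf ck); case: ifP => // h; case/negP: ck.
exact: mle_trans (mle_add d c) h.
Qed.

Lemma bsum_mshift (g : R[i] -> R) c x B : g 0 = 0 -> (forall z, 0 <= g z) ->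
  bsum (g \o x) B -> bsum (g \o mshift c x) B.
Proof.
move=> g0 gp h; apply: (bsum_fibers (p := fun k => msub k c)) h _ _ => [k|j A hA /=].
  exact: gp.
have [jA|jA] := boolP (madd c j \in A).
  rewrite (big_fsetD1 _ jA)/= mshift_madd big_seq big1 ?addr0// => k.
  rewrite !inE => /andP[kj /hA hk]; rewrite /mshift; case: ifP => // ck.
  by rewrite -hk msubK ?eqxx// in kj.
rewrite big_seq big1; first exact: gp.
move=> k kA; rewrite /mshift; case: ifP => // ck.
by move: jA; rewrite -(hA _ kA) msubK// kA.
Qed.

Lemma l2b_mshift c x B : l2b x B -> l2b (mshift c x) B.
Proof.
apply: (bsum_mshift (g := fun z => normc z ^+ 2)) => [|z]; last exact: sqr_ge0.
by rewrite normc0 expr0n.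
Qed.

(* Autocorrelation form of "multiplication by the power series [a] is an
   isometry": its translates are orthonormal. *)
Definition translates_orthonormal (a : mi n -> R[i]) := forall c d,
  has_sum (fun k => mshift c a k * (mshift d a k)^*) (if c == d then 1 else 0).

End shifts.

(** * Inner functions *)

Section inner_functions.
Context {R : realType} {n : nat}.
Implicit Types (c d k j : mi n) (a x y : mi n -> R[i]) (phi f : 'rV[R[i]]_n -> R[i]).
Local Notation mu := (torus_prob n : probability (n.-tuple (measurableTypeR R)) R).

Lemma polydiscP (z : 'rV[R[i]]_n) : polydisc z <-> forall i, normc (z ord0 i) < 1.
Proof. by split=> h i; have := h i; rewrite norm_normc ltcR. Qed.

Lemma taylor_coefs_expands f a : taylor_coefs f a <-> expands f 0 1 a.
Proof.
split=> h z hz.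
  rewrite subr0; apply: h; apply: (polydiscP z).2 => i.
  by have := hz i; rewrite [X in _ - X]mxE subr0.
have := h z; rewrite subr0; apply => i.
by rewrite [X in _ - X]mxE subr0; exact: (polydiscP z).1 hz i.
Qed.

Lemma taylor_coefs_uniq f g a b : taylor_coefs f a -> taylor_coefs g b ->
  (forall z, polydisc z -> f z = g z) -> a = b.
Proof.
move=> /taylor_coefs_expands ha /taylor_coefs_expands hb fg.
apply: (expands_uniq ltr01 ha hb) => w hw; apply: fg; apply/polydiscP => i.
by have := hw i; rewrite [X in _ - X]mxE subr0.
Qed.

Lemma inner_bound phi : is_inner phi ->
  exists M : R, forall z, polydisc z -> normc (phi z) <= M.
Proof.
by move=> [_ [M hM] _]; exists M => z /hM; rewrite norm_normc lecR.
Qed.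

Lemma inner_taylor phi : is_inner phi -> exists a, taylor_coefs phi a.
Proof.
move=> hphi; have [M hM] := inner_bound hphi; have [han _ _] := hphi.
have [z hz|z hz|a ha] := @expands_global _ _ phi M; last 1 first.
- by exists a; apply/taylor_coefs_expands.
- have [a [e [e0 ha]]] : exists a (e : R), 0 < e /\
      forall w : 'rV[R[i]]_n, (forall i, `|w ord0 i - z ord0 i| < e%:C) ->
      has_sum (fun k => a k * monomial k (w - z)) (phi w).
    by apply: han; exact: (polydiscP z).2.
  exists e => //; exists a => w hw; apply: ha => i.
  by rewrite norm_normc ltcR.
- exact: hM ((polydiscP z).2 hz).
Qed.

(** A sequence of radii turns radial limits into limits of sequences, to which dominated convergence
    applies. *)
Let rad (m : nat) : R := 1 - m.+1%:R^-1.

Let rad_itv m : 0 <= rad m < 1.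
Proof. by rewrite subr_ge0 invf_le1 ?ltr0n// ler1n/= gtrBl invr_gt0 ltr0n. Qed.

Let cvg_rad : rad m @[m --> \oo] --> (1 : R).
Proof.
rewrite -[X in _ --> X]subr0; apply: cvgB; first exact: cvg_cst.
exact: cvg_harmonic.
Qed.

Let cvgX (u : nat -> R) (l : R) e : u m @[m --> \oo] --> l -> u m ^+ e @[m --> \oo] --> l ^+ e.
Proof. by move=> h; exact: cvg_comp h (@exprn_continuous R e l). Qed.

Let cvg_radX e : (rad m) ^+ e @[m --> \oo] --> (1 : R).
Proof. by rewrite -(expr1n _ e); apply: cvgX; exact: cvg_rad. Qed.

Let has_sum_chr_shift (t : n.-tuple (measurableTypeR R)) c a F :
  has_sum (fun k => a k * chr k t) F ->
  has_sum (fun k => mshift c a k * chr k t) (chr c t * F).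
Proof.
move=> h; apply: (has_sum_madd (c := c)) => [k ck|].
  by rewrite /mshift (negPf ck) mul0r.
apply: eq_has_sum (has_sumZ (c := chr c t) h) => j.
by rewrite mshift_madd /chr monomialD; ring.
Qed.

Lemma Re_mul_inj (u v : R[i]) : (forall z, Re (z * u) = Re (z * v)) -> u = v.
Proof.
case: u v => [u1 u2] [v1 v2] h; have := h 1; have := h 'i%C.
by rewrite /= !mul0r !mul1r !sub0r !subr0 => /oppr_inj -> ->.
Qed.

(** Parseval is applied to [z^c phi(r z)] and [z^d phi(r z)] on the torus, with [r = rad m]. As [m]
    grows, the coefficient side tends to the inner product of the translates, and the integral side
    to that of [chr c] and [chr d], because [|phi|] has radial limit 1 almost everywhere. *)
Lemma inner_translates_orthonormal phi a : is_inner phi -> taylor_coefs phi a ->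
  translates_orthonormal a.
Proof.
move=> hphi ha; have [M hM] := inner_bound hphi; have [_ _ hr] := hphi.
pose ar m k := a k * (rad m ^+ mdeg k)%:C.
pose F m (t : n.-tuple (measurableTypeR R)) := phi ((rad m)%:C *: torus_point t).
have radc m (t : n.-tuple (measurableTypeR R)) : polydisc ((rad m)%:C *: torus_point t).
  have /andP[r0 r1] := rad_itv m.
  by apply/polydiscP => i; rewrite !mxE normcM normc_expi mulr1 normcR ger0_norm.
have hF m t : has_sum (fun k => ar m k * chr k t) (F m t).
  by apply: eq_has_sum (ha _ (radc m t)) => k; rewrite monomial_torus mulrA.
have FM m t : normc (F m t) <= M by exact: hM.
have M0 : 0 <= M by rewrite (le_trans _ (FM 0%N [tuple 0 | i < n])) ?normc_ge0.
have nar m k : normc (ar m k) = normc (a k) * rad m ^+ mdeg k.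
  by have /andP[r0 _] := rad_itv m; rewrite normcM normcR ger0_norm ?exprn_ge0.
have har m : exists B, bsum (fun k => normc (a k) * rad m ^+ mdeg k) B.
  by have /taylor_coefs_expands/expands_bsum := ha; apply; exact: rad_itv.
(* The bound of [cauchy_l2] at radius [rad m] does not depend on [m], and passes to the limit in
   each finite sum. *)
have l2a : l2b a (M ^+ 2).
  move=> A; have h m : \sum_(k <- A) normc (ar m k) ^+ 2 <= M ^+ 2.
    have [B hB] := har m; have /andP[r0 _] := rad_itv m.
    have := @cauchy_l2 _ _ a (F m) (rad m) B M r0 hB _ (FM m) A.
    under eq_bigr do rewrite -nar; apply => t.
    exact: ha.
  have cv : (\sum_(k <- A) normc (ar m k) ^+ 2) @[m --> \oo] --> \sum_(k <- A) normc (a k) ^+ 2.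
    apply: (cvg_sumr (r := enum_fset A) (u := fun k m => normc (ar m k) ^+ 2)) => k.
    under eq_fun do rewrite nar; apply: cvgX.
    by rewrite -[X in _ --> X]mulr1; apply: cvgMr; exact: cvg_radX.
  by apply: (ler_cvg_to cv (cvg_cst (M ^+ 2))); exact: nearW.
move=> c d.
have [s hs] := l2b_ip (l2b_mshift c l2a) (l2b_mshift d l2a).
suff -> : (if c == d then 1 else 0) = s :> R[i] by [].
have hsm m : exists s', has_sum (fun k => mshift c (ar m) k * (mshift d (ar m) k)^*) s'.
  have lar : l2b (ar m) (M ^+ 2).
    apply: bsum_le l2a => // k; rewrite nar; have /andP[r0 r1] := rad_itv m.
    rewrite lerXn2r ?nnegrE ?mulr_ge0 ?normc_ge0 ?exprn_ge0//.
    by rewrite ler_piMr ?normc_ge0// exprn_ile1// ltW.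
  exact: l2b_ip (l2b_mshift c lar) (l2b_mshift d lar).
have [sm {}hsm] := choice hsm.
(* Dilation only decreases moduli, so the product of the undilated translates is a summable
   majorant. *)
have ssm : normc (sm m - s) @[m --> \oo] --> (0 : R).
  apply: (has_sum_dominated (l2b_mul (l2b_mshift c l2a) (l2b_mshift d l2a)) _ _ hsm hs).
    move=> m k; rewrite normcM normc_conj; have /andP[r0 r1] := rad_itv m.
    rewrite ler_pM ?normc_ge0// /mshift; case: ifP => _; rewrite ?normc0//.
      by rewrite nar ler_piMr ?normc_ge0// exprn_ile1// ltW.
    by rewrite nar ler_piMr ?normc_ge0// exprn_ile1// ltW.
  move=> k; pose e := (mdeg (msub k c) + mdeg (msub k d))%N.
  have E m : mshift c (ar m) k * (mshift d (ar m) k)^* - mshift c a k * (mshift d a k)^*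
      = mshift c a k * (mshift d a k)^* * (rad m ^+ e - 1)%:C.
    rewrite /mshift; case: ifP => _; last by rewrite !mul0r subr0.
    case: ifP => _; last by rewrite !rmorph0 !mulr0 !mul0r subr0.
    rewrite /ar rmorphM /= exprD rmorphB rmorphM rmorph1.
    have -> : ((rad m ^+ mdeg (msub k d))%:C)^* = (rad m ^+ mdeg (msub k d))%:C.
      exact: conjc_real.
    ring.
  have h0 : `|rad m ^+ e - 1| @[m --> \oo] --> (0 : R).
    rewrite -(normr0 R) -(subrr (1 : R)).
    by apply: cvg_norm; apply: cvgB; [exact: cvg_radX|exact: cvg_cst].
  have := @cvgMr _ _ _ _ _ (normc (mshift c a k * (mshift d a k)^*)) _ h0.
  rewrite mulr0 => h1.
  have E2 m : normc (mshift c (ar m) k * (mshift d (ar m) k)^* - mshift c a k * (mshift d a k)^*)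
      = normc (mshift c a k * (mshift d a k)^*) * `|rad m ^+ e - 1|.
    by rewrite E normcM normcR.
  by rewrite -(funext E2) in h1; exact: h1.
(* Testing real parts against every [z] reduces the complex identity to real integrals. *)
apply: Re_mul_inj => z.
pose g_ m (t : n.-tuple (measurableTypeR R)) :=
  Re (z * (chr c t * F m t * (chr d t * F m t)^*)).
pose g (t : n.-tuple (measurableTypeR R)) := Re (z * (chr c t * (chr d t)^*)).
have gE m t : g_ m t = g t * normc (F m t) ^+ 2.
  rewrite /g_ /g rmorphM /=.
  have -> : z * (chr c t * F m t * ((chr d t)^* * (F m t)^*)) =
    z * (chr c t * (chr d t)^*) * (F m t * (F m t)^*) by ring.
  by rewrite mulc_conj; case: (z * _) => u v /=; rewrite mulr0 subr0.
have hP m : measurable_fun setT (g_ m) /\ (\int[mu]_t (g_ m t)%:E = (Re (z * sm m))%:E)%E.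
  have [B hB] := har m.
  have hB' e : bsum (normc \o mshift e (ar m)) B.
    apply: (bsum_mshift (g := normc)) => [||]; [exact: normc0|exact: normc_ge0|].
    by apply: bsum_le hB => // k /=; rewrite nar.
  have [h1 h2] := (parseval z (F := fun t => chr c t * F m t) (G := fun t => chr d t * F m t)
    (hB' c) (hB' d) (fun t => has_sum_chr_shift (c := c) (hF m t))
    (fun t => has_sum_chr_shift (c := d) (hF m t)) (hsm m)).
  split; first exact: h1. exact: h2.
have mg : measurable_fun setT g.
  by rewrite /g; under eq_fun do rewrite chrM_conj; exact: measurable_Re_expi.
have gz t : `|g t| <= normc z.
  by rewrite (le_trans (normc_Re _))// !normcM normc_conj !normc_chr !mulr1.
have gK m t : `|g_ m t| <= normc z * M ^+ 2.
  rewrite gE normrM ler_pM// ger0_norm ?sqr_ge0//.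
  by rewrite lerXn2r ?nnegrE ?normc_ge0.
have gg : {ae mu, forall t, g_ ^~ t @ \oo --> g t}.
  apply: (@filterS _ _ (ae_filter_ringOfSetsType mu) _ _ _ hr) => t [l hl l1].
  have Fl e : 0 < e -> \forall m \near \oo, normc (F m t - l) < e.
    move=> e0; have e0' : 0 < e%:C by rewrite ltcR.
    have h : \forall r \near (1 : R)^'-, normc (phi (r%:C *: torus_point t) - l) < e.
      move/cvgrPdist_lt : hl => /(_ _ e0'); apply: filterS => r.
      by rewrite norm_normc ltcR normcB.
    have hm : \forall m \near \oo, rad m < 1 -> normc (F m t - l) < e.
      move: h; rewrite near_withinE => h.
      exact: (cvg_rad h).
    by apply: filterS hm => m; apply; have /andP[] := rad_itv m.
  have nl : normc l = 1 by apply: complexI; rewrite -norm_normc.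
  have Fn : normc (F m t) @[m --> \oo] --> (1 : R).
    apply/cvgrPdist_lt => e /Fl; apply: filterS => m; rewrite -nl => h.
    have := le_normcD (F m t) (l - F m t); have := le_normcD l (F m t - l).
    rewrite !subrKC (normcB l) => h1 h2; rewrite ltr_norml; apply/andP; split; lra.
  have := @cvgMr _ _ _ _ _ (g t) _ (cvgX (e := 2) Fn).
  rewrite expr1n mulr1 => h; rewrite (_ : g_ ^~ t = fun m => g t * normc (F m t) ^+ 2); first exact: h.
  by apply/funext => m; exact: gE.
have lim1 : (\int[mu]_t (g_ m t)%:E)%E @[m --> \oo] --> (\int[mu]_t (g t)%:E)%E.
  exact: (prob_bounded_cvg (fun m => (hP m).1) mg gK gg).
have lim2 : (\int[mu]_t (g_ m t)%:E)%E @[m --> \oo] --> (Re (z * s))%:E.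
  under eq_fun do rewrite (hP _).2.
  apply: cvg_EFin; first exact: nearW.
  apply/cvgrPdist_le => e e0; have z1 : 0 < normc z + 1 by rewrite ltr_wpDl ?normc_ge0.
  have /cvgrPdist_le /(_ _ (divr_gt0 e0 z1))[N _ hN] := ssm.
  exists N => // m /= /hN; rewrite sub0r normrN ger0_norm ?normc_ge0// ler_pdivlMr// => h.
  have -> : Re (z * s) - Re (z * sm m) = Re (z * (s - sm m)).
    by rewrite mulrBr; case: (z * s) (z * sm m) => ? ? [].
  rewrite (le_trans (normc_Re _))// normcM normcB mulrC (le_trans _ h)//.
  by rewrite ler_wpM2l ?normc_ge0// lerDl.
have : (\int[mu]_t (g t)%:E = (Re (z * s))%:E)%E by apply: cvg_unique lim1 lim2.
rewrite /g integral_chrM_conj => -[<-].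
by case: eqP => _; rewrite ?mulr1 ?mulr0.
Qed.

End inner_functions.

(** * Square-summable families and bounded functionals *)

Section l2_theory.
Context {R : realType} {I : choiceType}.
Implicit Types (x y u v : I -> R[i]) (D : {fset I}).

Definition l2 x := exists B, l2b x B.

Definition l2ip x y : R[i] := usum (fun k => x k * (y k)^*).

Lemma l2ipP x y : l2 x -> l2 y -> has_sum (fun k => x k * (y k)^*) (l2ip x y).
Proof. by move=> [B hB] [C hC]; have [s hs] := l2b_ip hB hC; rewrite /l2ip (usumE hs). Qed.

Lemma l2ip_le x y B C : l2b x B -> l2b y C -> normc (l2ip x y) <= Num.sqrt (B * C).
Proof. by move=> hx hy; apply: (l2b_ip_le hx hy); apply: l2ipP; [exists B|exists C]. Qed.

Lemma normc_sqD (z w : R[i]) : normc (z + w) ^+ 2 <= 2 * normc z ^+ 2 + 2 * normc w ^+ 2.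
Proof.
have h : normc (z + w) ^+ 2 <= (normc z + normc w) ^+ 2.
  by rewrite lerXn2r ?nnegrE ?addr_ge0 ?normc_ge0// le_normcD.
by apply: le_trans h _; have := sqr_ge0 (normc z - normc w); nra.
Qed.

Lemma l2D x y : l2 x -> l2 y -> l2 (fun k => x k + y k).
Proof.
move=> [B hB] [C hC]; exists (2 * B + 2 * C).
apply: bsum_le (bsumD (bsumZ (ler0n _ 2) hB) (bsumZ (ler0n _ 2) hC)) => // k.
exact: normc_sqD.
Qed.

Lemma l2N x : l2 x -> l2 (fun k => - x k).
Proof. by move=> [B hB]; exists B; apply: bsum_le hB => // k; rewrite normcN. Qed.

Lemma l2B x y : l2 x -> l2 y -> l2 (fun k => x k - y k).
Proof. by move=> hx hy; exact: l2D hx (l2N hy). Qed.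

Lemma l2ipB x y v : l2 x -> l2 y -> l2 v -> l2ip (fun k => x k - y k) v = l2ip x v - l2ip y v.
Proof.
move=> hx hy hv; apply: usumE; apply: eq_has_sum (has_sumB (l2ipP hx hv) (l2ipP hy hv)) => k.
by rewrite mulrBl.
Qed.

Definition off D x : I -> R[i] := fun k => if k \in D then 0 else x k.

Lemma l2b_off D x B : (forall A : {fset I}, {in A, forall k, k \notin D} ->
  \sum_(k <- A) normc (x k) ^+ 2 <= B) -> l2b (off D x) B.
Proof.
move=> h; apply: (@bsum_off _ _ _ _ D) => [A AD|k kD]; last by rewrite /off kD normc0 expr0n.
apply: (le_trans _ (h A AD)); rewrite big_seq [leRHS]big_seq ler_sum// => k /AD /negPf kD.
by rewrite /off kD.
Qed.

Lemma l2_off D x : l2 x -> l2 (off D x).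
Proof. by move=> [B hB]; exists B; apply: l2b_off => A _; exact: hB. Qed.

(** The remainder after a finite set [D] is [L (off D x)], small because the tail of [x] is small in
    norm. Linearity is asked only as the splitting off of finitely many coordinates. *)
Lemma has_sum_bounded_functional (L : (I -> R[i]) -> R[i]) (e : I -> R[i]) (K : R) x :
  0 <= K ->
  (forall D x, l2 x -> L x = \sum_(j <- D) x j * e j + L (off D x)) ->
  (forall x B, l2b x B -> normc (L x) <= Num.sqrt (B * K)) ->
  l2 x -> has_sum (fun j => x j * e j) (L x).
Proof.
move=> K0 hD hL hx; have [B hB] := hx; apply/has_sumP => eps eps0.
have K1 : 0 < K + 1 by rewrite ltr_wpDl.
(* Chosen so that [Num.sqrt (eta * K) <= eps / 2]; [K + 1] avoids dividing by zero. *)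
pose eta := (eps / 2) ^+ 2 / (K + 1).
have eta0 : 0 < eta by rewrite divr_gt0// exprn_gt0// divr_gt0.
have [A hA] := bsum_tail (fun k => sqr_ge0 (normc (x k))) hB eta0.
exists A => D AD; rewrite (hD D x hx) opprD addrA subrr sub0r normcN.
apply: (@le_lt_trans _ _ (eps / 2)); last by rewrite ltr_pdivrMr// ltr_pMr// ltr1n.
have hoff : l2b (off D x) eta.
  apply: l2b_off => C CD; apply/ltW/hA => k /CD; apply: contra; exact: (fsubsetP AD).
apply: (le_trans (hL _ _ hoff)).
have e2 : 0 <= eps / 2 by rewrite divr_ge0// ltW.
rewrite -[leRHS]ger0_norm// -sqrtr_sqr ler_sqrt ?sqr_ge0//.
rewrite /eta mulrAC ler_pdivrMr// ler_wpM2l ?sqr_ge0//.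
by rewrite lerDl.
Qed.

End l2_theory.

(** * Convolution by a family with orthonormal translates *)

Section convolution.
Context {R : realType} {n : nat}.
Implicit Types (c d k j m : mi n) (a b x y u v : mi n -> R[i]) (D : {fset mi n}).

Lemma l2_mshift c x : l2 x -> l2 (mshift c x).
Proof. by move=> [B hB]; exists B; exact: l2b_mshift. Qed.

Lemma translates_orthonormal_mshift k a :
  translates_orthonormal a -> translates_orthonormal (mshift k a).
Proof.
move=> ha c d; rewrite !mshiftD.
have := ha (madd c k) (madd d k).
by rewrite ![madd _ k]maddC (inj_eq (@maddI _ k)).
Qed.

Lemma translates_orthonormal_l2b a : translates_orthonormal a -> l2b a 1.
Proof.
move=> /(_ mi0 mi0); rewrite eqxx mshift0 => h.
apply: (has_sum_ge (s := 1)) => [k|]; first exact: sqr_ge0.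
by apply: eq_has_sum h => k; rewrite mulc_conj.
Qed.

Lemma translates_orthonormal_l2 a : translates_orthonormal a -> l2 a.
Proof. by move=> /translates_orthonormal_l2b; exists 1. Qed.

Lemma has_sum_l2ip_mshift k y v : l2 y -> l2 v ->
  has_sum (fun j => y j * (v (madd k j))^*) (l2ip (mshift k y) v).
Proof.
move=> [B hB] [C hC].
have hv : l2b (fun j => v (madd k j)) C.
  move=> A; apply: le_trans (hC (madd k @` A)%fset).
  by rewrite big_imfset//= => i j _ _; exact: maddI.
have [s hs] := l2b_ip hB hv.
suff -> : l2ip (mshift k y) v = s by [].
apply: usumE; apply: (has_sum_madd (c := k)) => [j kj|].
  by rewrite /mshift (negPf kj) mul0r.
by apply: eq_has_sum hs => j; rewrite mshift_madd.
Qed.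

Lemma l2ip_mshift2 c x y : l2 x -> l2 y -> l2ip (mshift c x) (mshift c y) = l2ip x y.
Proof.
move=> hx hy; apply: (has_sum_unique (has_sum_l2ip_mshift (k := c) hx (l2_mshift c hy))).
by apply: eq_has_sum (l2ipP hx hy) => j; rewrite mshift_madd.
Qed.

(** The Cauchy product, seen as a combination of translates of [a]. Only the [j] below [m]
    contribute, so it makes sense for arbitrary families. *)
Definition mconv a x m : R[i] := usum (fun j => x j * mshift j a m).

Lemma has_sum_mconv_box N a x m : m \in box N ->
  has_sum (fun j => x j * mshift j a m) (\sum_(j <- box N) x j * mshift j a m).
Proof.
move=> mN; apply: has_sum_fin => j jN; rewrite /mshift; case: ifP => [/forallP jm|]; last by rewrite mulr0.
case/negP: jN; rewrite !mem_box in mN *; apply/forallP => i.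
exact: leq_ltn_trans (jm i) (forallP mN i).
Qed.

Lemma mconv_box N a x m : m \in box N ->
  mconv a x m = \sum_(j <- box N) x j * mshift j a m.
Proof. by move=> mN; exact: usumE (has_sum_mconv_box mN). Qed.

Lemma mem_box_ex m : exists N, m \in box N.
Proof.
by have [N /fsubsetP h] := box_cofinal [fset m]%fset; exists N; rewrite h// inE.
Qed.

Lemma has_sum_mconv a x m : has_sum (fun j => x j * mshift j a m) (mconv a x m).
Proof. by have [N mN] := mem_box_ex m; rewrite (mconv_box _ _ mN); exact: has_sum_mconv_box. Qed.

Lemma mconvB a x y : mconv a (fun k => x k - y k) = fun m => mconv a x m - mconv a y m.
Proof.
apply/funext => m; apply: usumE.
by apply: eq_has_sum (has_sumB (has_sum_mconv (a := a) (x := x) (m := m))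
  (has_sum_mconv (a := a) (x := y) (m := m))) => j; rewrite mulrBl.
Qed.

Let comb D a x m := \sum_(j <- D) x j * mshift j a m.

Lemma has_sum_comb D a x : translates_orthonormal a ->
  has_sum (fun m => comb D a x m * (comb D a x m)^*) (\sum_(j <- D) normc (x j) ^+ 2)%:C.
Proof.
move=> ha.
have h : has_sum (fun m => \sum_(j <- D) \sum_(l <- D)
    x j * (x l)^* * (mshift j a m * (mshift l a m)^*))
    (\sum_(j <- D) \sum_(l <- D) x j * (x l)^* * (if j == l then 1 else 0)).
  by apply: has_sum_sum => j; apply: has_sum_sum => l; exact: has_sumZ (ha j l).
rewrite rmorph_sum big_seq; rewrite big_seq in h.
rewrite (eq_bigr (fun j => \sum_(l <- D) x j * (x l)^* * (if j == l then 1 else 0))).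
  apply: eq_has_sum h => m; rewrite /comb rmorph_sum mulr_suml; apply: eq_bigr => j _.
  rewrite mulr_sumr; apply: eq_bigr => l _.
  by rewrite rmorphM /=; ring.
move=> j jD; rewrite (big_fsetD1 _ jD)/= eqxx mulr1 mulc_conj big_seq big1 ?addr0// => l.
by rewrite !inE eq_sym => /andP[/negPf ->]; rewrite mulr0.
Qed.

Lemma l2b_comb D a x : translates_orthonormal a ->
  l2b (comb D a x) (\sum_(j <- D) normc (x j) ^+ 2).
Proof.
move=> ha; apply: (has_sum_ge (s := (\sum_(j <- D) normc (x j) ^+ 2)%:C)) => [m|]; first exact: sqr_ge0.
by apply: eq_has_sum (has_sum_comb (D := D) (x := x) ha) => m; rewrite mulc_conj.
Qed.

(** On a box the convolution equals a finite combination of translates, whose norm is given by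
    Pythagoras in [has_sum_comb]. *)
Lemma l2b_mconv a x B : translates_orthonormal a -> l2b x B -> l2b (mconv a x) B.
Proof.
move=> ha hB A; have [N /fsubsetP AN] := box_cofinal A.
apply: le_trans (hB (box N)); apply: le_trans (l2b_comb (box N) x ha A).
by rewrite big_seq [leRHS]big_seq ler_sum// => m /AN mN; rewrite (mconv_box _ _ mN).
Qed.

Lemma l2_mconv a x : translates_orthonormal a -> l2 x -> l2 (mconv a x).
Proof. by move=> ha [B hB]; exists B; exact: l2b_mconv. Qed.

Lemma mconv_off D a x m : mconv a x m = comb D a x m + mconv a (off D x) m.
Proof.
have h := has_sumB (has_sum_mconv (a := a) (x := x) (m := m))
  (has_sum_mconv (a := a) (x := off D x) (m := m)).
apply/eqP; rewrite -subr_eq; apply/eqP; apply: (has_sum_unique h).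
have hf : forall j, j \notin D -> x j * mshift j a m - off D x j * mshift j a m = 0.
  by move=> j jD; rewrite /off (negPf jD) subrr.
have := has_sum_fin hf.
rewrite /comb [in X in X -> _]big_seq [in X in _ -> X]big_seq.
by under eq_bigr => j jD do rewrite /off jD mul0r subr0.
Qed.

(** By [l2b_mconv] the left factor [x] enters through a bounded functional, which is determined by
    its values on coordinates. *)
Lemma has_sum_l2ip_mconv a x v : translates_orthonormal a -> l2 x -> l2 v ->
  has_sum (fun j => x j * l2ip (mshift j a) v) (l2ip (mconv a x) v).
Proof.
move=> ha hx hv; have [C hC] := hv; have la := translates_orthonormal_l2 ha.
apply: (has_sum_bounded_functional (L := fun x => l2ip (mconv a x) v)) (bsum_ge0 hC) _ _ hx.
  move=> D {}x {}hx; apply: usumE.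
  have h1 : has_sum (fun m => \sum_(j <- D) x j * (mshift j a m * (v m)^*))
      (\sum_(j <- D) x j * l2ip (mshift j a) v).
    by apply: has_sum_sum => j; apply: has_sumZ; exact: l2ipP (l2_mshift j la) hv.
  have h2 := l2ipP (l2_mconv ha (l2_off D hx)) hv.
  apply: eq_has_sum (has_sumD h1 h2) => m.
  rewrite [in RHS](mconv_off D) mulrDl /comb mulr_suml; congr (_ + _).
  by apply: eq_bigr => j _; rewrite mulrA.
by move=> {}x B hB; apply: l2ip_le => //; exact: l2b_mconv.
Qed.

(** The adjoint of convolution by [a] is a left inverse of it; in particular this convolution is
    injective on [l2]. *)
Lemma l2ip_mconv_mshift a x d : translates_orthonormal a -> l2 x ->
  l2ip (mconv a x) (mshift d a) = x d.
Proof.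
move=> ha hx; have la := translates_orthonormal_l2 ha.
apply: (has_sum_unique (has_sum_l2ip_mconv ha hx (l2_mshift d la))).
have hf : forall j, j \notin [fset d]%fset -> x j * l2ip (mshift j a) (mshift d a) = 0.
  by move=> j; rewrite inE => /negPf jd; rewrite /l2ip (usumE (ha j d)) jd mulr0.
by have := has_sum_fin hf; rewrite big_seq_fset1 /l2ip (usumE (ha d d)) eqxx mulr1.
Qed.

(** Pair [x] with its projection on the translates indexed by [A]: the inner product is [S] and the
    projection has squared norm at most [S], so Cauchy-Schwarz gives [S ^+ 2 <= B * S]. *)
Lemma bessel a x B : translates_orthonormal a -> l2b x B ->
  l2b (fun e => l2ip x (mshift e a)) B.
Proof.
move=> ha hB A; have la := translates_orthonormal_l2 ha.
have hx : l2 x by exists B.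
pose c e := l2ip x (mshift e a); pose S := \sum_(e <- A) normc (c e) ^+ 2.
have hy := l2b_comb A c ha.
have E : l2ip x (comb A a c) = S%:C.
  apply: usumE.
  have h : has_sum (fun m => \sum_(e <- A) (c e)^* * (x m * (mshift e a m)^*))
      (\sum_(e <- A) (c e)^* * c e).
    by apply: has_sum_sum => e; apply: has_sumZ; exact: l2ipP hx (l2_mshift e la).
  have -> : S%:C = \sum_(e <- A) (c e)^* * c e.
    by rewrite rmorph_sum; apply: eq_bigr => e _; rewrite [RHS]mulrC mulc_conj.
  apply: eq_has_sum h => m; rewrite /comb rmorph_sum mulr_sumr.
  by apply: eq_bigr => e _; rewrite rmorphM /=; ring.
have S0 : 0 <= S by rewrite sumr_ge0// => e _; rewrite sqr_ge0.
have := l2ip_le hB hy; rewrite E normcR ger0_norm// => h.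
have B0 := bsum_ge0 hB.
have : S ^+ 2 <= B * S.
  by rewrite -[leRHS]sqr_sqrtr ?mulr_ge0// lerXn2r ?nnegrE ?sqrtr_ge0.
rewrite -/S; have [->//|SN] := eqVneq S 0.
have Sp : 0 < S by rewrite lt_def SN.
by rewrite expr2 ler_pM2r.
Qed.

(* For [k <= N] the translate by [N - k] turns [<z^k y, z^d b>] into
   [<z^N y, z^(N - k + d) b>], so Bessel's inequality applies. *)
Lemma l2b_l2ip_mshift b y d B : translates_orthonormal b -> l2b y B ->
  l2b (fun k => l2ip (mshift k y) (mshift d b)) B.
Proof.
move=> hb hB A; have [N /fsubsetP AN] := box_cofinal A.
have ly : l2 y by exists B.
have lb := translates_orthonormal_l2 hb.
pose mN : mi n := [ffun => N].
have kN k : k \in A -> mle k mN.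
  move=> /AN; rewrite mem_box => /forallP h; apply/forallP => i.
  by rewrite ffunE ltnW.
pose r k := madd (msub mN k) d.
have rI : {in A &, injective r}.
  move=> k l /kN hk /kN hl; rewrite /r ![madd _ d]maddC => /maddI E.
  have : madd (msub mN k) k = madd (msub mN k) l by rewrite {2}E ![madd (msub _ _) _]maddC !msubK.
  exact: maddI.
apply: le_trans (bessel hb (l2b_mshift mN hB) (r @` A)%fset).
rewrite big_imfset//= big_seq [leRHS]big_seq ler_sum// => k kA.
by rewrite -(l2ip_mshift2 (msub mN k) (l2_mshift k ly) (l2_mshift d lb)) !mshiftD maddC msubK// kN.
Qed.

(** Here the expansion runs along the coefficients of [a], whereas [has_sum_l2ip_mconv] expands
    along those of [y]. By [l2b_l2ip_mshift] and Cauchy-Schwarz the series [L y] converges and is a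
    bounded functional of [y]; it has the same values on coordinates. *)
Lemma has_sum_l2ip_mconv_l a b y d : translates_orthonormal a ->
  translates_orthonormal b -> l2 y ->
  has_sum (fun k => a k * l2ip (mshift k y) (mshift d b)) (l2ip (mconv a y) (mshift d b)).
Proof.
move=> ha hb ly; set v := mshift d b; have la := translates_orthonormal_l2 ha.
have lv : l2 v by apply: l2_mshift; exact: translates_orthonormal_l2.
pose L y := usum (fun k => a k * l2ip (mshift k y) v).
have hL z : l2 z -> has_sum (fun k => a k * l2ip (mshift k z) v) (L z).
  move=> [B hB]; have hc : l2b (fun k => (l2ip (mshift k z) v)^*) B.
    by apply: bsum_le (l2b_l2ip_mshift d hb hB) => // k; rewrite normc_conj.
  have [s hs] := l2b_ip (translates_orthonormal_l2b ha) hc.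
  suff hs' : has_sum (fun k => a k * l2ip (mshift k z) v) s by rewrite /L (usumE hs').
  by apply: eq_has_sum hs => k; rewrite conjCK.
suff <- : L y = l2ip (mconv a y) v by exact: hL.
apply: has_sum_unique (has_sum_l2ip_mconv ha ly lv).
apply: (has_sum_bounded_functional (L := L) (K := 1)) ler01 _ _ ly.
  move=> D x hx; apply: usumE.
  have h1 : has_sum (fun k => \sum_(j <- D) x j * (a k * (v (madd k j))^*))
      (\sum_(j <- D) x j * l2ip (mshift j a) v).
    apply: has_sum_sum => j; apply: has_sumZ.
    by apply: eq_has_sum (has_sum_l2ip_mshift (k := j) la lv) => k; rewrite maddC.
  apply: eq_has_sum (has_sumD h1 (hL _ (l2_off D hx))) => k.
  have h2 := has_sumB (has_sum_l2ip_mshift (k := k) hx lv) (has_sum_l2ip_mshift (k := k) (l2_off D hx) lv).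
  have hf : forall j, j \notin D -> x j * (v (madd k j))^* - off D x j * (v (madd k j))^* = 0.
    by move=> j jD; rewrite /off (negPf jD) subrr.
  have := has_sum_unique h2 (has_sum_fin hf) => E.
  rewrite -[l2ip (mshift k x) v](subrK (l2ip (mshift k (off D x)) v)) E mulrDr; congr (_ + _).
  rewrite mulr_sumr big_seq [RHS]big_seq; apply: eq_bigr => j jD.
  by rewrite /off jD mul0r subr0; ring.
move=> z B hB.
have hc : l2b (fun k => (l2ip (mshift k z) v)^*) B.
  by apply: bsum_le (l2b_l2ip_mshift d hb hB) => // k; rewrite normc_conj.
rewrite mulrC; apply: (l2b_ip_le (translates_orthonormal_l2b ha) hc).
by apply: eq_has_sum (hL z _) => [k|]; [rewrite conjCK|exists B].
Qed.

End convolution.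

(** * Products of Taylor series and division *)

Section taylor_product.
Context {R : realType} {n : nat}.
Implicit Types (c d k j m : mi n) (a b x y u v : mi n -> R[i]) (D : {fset mi n}).
Implicit Types (f g : 'rV[R[i]]_n -> R[i]).

Lemma bsum_madd c (g : mi n -> R) B : (forall k, 0 <= g k) ->
  (forall k, ~~ mle c k -> g k = 0) -> bsum (fun j => g (madd c j)) B -> bsum g B.
Proof.
move=> g0 gc h; apply: (bsum_fibers (p := fun k => msub k c) h g0) => j A hA.
have hk k : k \in A -> k != madd c j -> g k = 0.
  move=> /hA hk kj; apply: gc; apply: contra kj => ck.
  by rewrite -hk msubK.
have [jA|jA] := boolP (madd c j \in A).
  rewrite (big_fsetD1 _ jA)/= big_seq big1 ?addr0// => k.
  by rewrite !inE => /andP[kj kA]; exact: hk.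
rewrite big_seq big1; first exact: g0.
by move=> k kA; apply: hk => //; apply: contra jA => /eqP <-.
Qed.

(** The family [A] of products of terms, indexed by a factor [j] and the total index [m], is
    absolutely summable: summing over [m] first gives [f z * g z], over [j] first the
    convolution. *)
Lemma taylor_mul f g a x : taylor_coefs f a -> taylor_coefs g x ->
  taylor_coefs (f \* g) (mconv a x).
Proof.
move=> hf hg z hz; have {}hf := hf z hz; have {}hg := hg z hz.
have [Ba hBa] := has_sum_bsum hf; have [Bx hBx] := has_sum_bsum hg.
pose A (p : mi n * mi n) := x p.1 * mshift p.1 a p.2 * monomial p.2 z.
have Az j m : ~~ mle j m -> A (j, m) = 0.
  by move=> jm; rewrite /A /mshift (negPf jm) mulr0 mul0r.
have Ad j l : A (j, madd j l) = x j * monomial j z * (a l * monomial l z).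
  by rewrite /A /= mshift_madd monomialD; ring.
have hA : bsum (normc \o A) (Ba * Bx).
  apply: (bsum_pair _ (bsumZ (bsum_ge0 hBa) hBx)) => [k|j]; first exact: normc_ge0.
  apply: (bsum_madd (c := j)) => [m|m jm|].
  - exact: normc_ge0.
  - by rewrite /= Az// normc0.
  apply: bsum_le (bsumZ (normc_ge0 (x j * monomial j z)) hBa) => [l /=|].
    by rewrite Ad normcM.
  by rewrite mulrC.
have [s hs] := bsum_has_sum hA.
have h1 : has_sum (fun j => f z * (x j * monomial j z)) s.
  apply: has_sum_fst hs _ => j; apply: (has_sum_madd (c := j)) => [m /Az//|].
  rewrite [f z * _]mulrC; apply: eq_has_sum (has_sumZ (c := x j * monomial j z) hf) => l.
  by rewrite Ad.
have {h1} s_ := has_sum_unique h1 (has_sumZ (c := f z) hg).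
rewrite /= -s_; apply: has_sum_snd hs _ => m.
have := has_sumZ (c := monomial m z) (has_sum_mconv (a := a) (x := x) (m := m)).
by rewrite mulrC; apply: eq_has_sum => j; rewrite /A /=; ring.
Qed.

Lemma taylor_mshift f a c : taylor_coefs f a ->
  taylor_coefs (monomial c \* f) (mshift c a).
Proof.
move=> hf z hz; apply: (has_sum_madd (c := c)) => [k ck|].
  by rewrite /mshift (negPf ck) mul0r.
apply: eq_has_sum (has_sumZ (c := monomial c z) (hf z hz)) => j.
by rewrite mshift_madd monomialD; ring.
Qed.

Definition power_series x (z : 'rV[R[i]]_n) : R[i] := usum (fun k => x k * monomial k z).

Lemma taylor_power_series x : l2 x -> taylor_coefs (power_series x) x.
Proof.
move=> [B hB] z /polydiscP hz.
have [r /andP[r0 r1] zr] := normc_row_lt ltr01 hz.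
have xB k : normc (x k) * 1 ^+ mdeg k <= Num.sqrt B.
  rewrite expr1n mulr1 -[leLHS]ger0_norm ?normc_ge0// -sqrtr_sqr ler_sqrt ?(bsum_ge0 hB)//.
  exact: bsum1 hB.
have [C hC] := bsum_powers xB (introT andP (conj r0 r1)).
have [s hs] : exists s, has_sum (fun k => x k * monomial k z) s.
  apply: (@bsum_has_sum _ _ _ C); apply: bsum_le hC => // k /=.
  by rewrite normcM ler_wpM2l ?normc_ge0// normc_monomial.
by rewrite /power_series (usumE hs).
Qed.

(** Algebraic laws of [mconv] are read off from products of functions, by uniqueness of Taylor
    coefficients. *)
Lemma mconvCA a b x : l2 a -> l2 b -> l2 x ->
  mconv a (mconv b x) = mconv b (mconv a x).
Proof.
move=> la lb lx.
have [[ta tb] tx] := (taylor_power_series la, taylor_power_series lb, taylor_power_series lx).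
apply: (@taylor_coefs_uniq _ _ _ _ _ _ (taylor_mul ta (taylor_mul tb tx))
  (taylor_mul tb (taylor_mul ta tx))) => z _ /=.
by rewrite mulrCA.
Qed.

Lemma mconv_mshiftr a x c : l2 a -> l2 x -> mconv a (mshift c x) = mshift c (mconv a x).
Proof.
move=> la lx; have [ta tx] := (taylor_power_series la, taylor_power_series lx).
apply: (@taylor_coefs_uniq _ _ _ _ _ _ (taylor_mul ta (taylor_mshift (c := c) tx))
  (taylor_mshift (c := c) (taylor_mul ta tx))) => z _ /=.
by rewrite mulrCA.
Qed.

Lemma mconv_mshiftl a x c : l2 a -> l2 x -> mconv (mshift c a) x = mshift c (mconv a x).
Proof.
move=> la lx; have [ta tx] := (taylor_power_series la, taylor_power_series lx).
apply: (@taylor_coefs_uniq _ _ _ _ _ _ (taylor_mul (taylor_mshift (c := c) ta) tx)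
  (taylor_mshift (c := c) (taylor_mul ta tx))) => z _ /=.
by rewrite mulrA.
Qed.

(** * Division in [l^2] under a trivial joint kernel *)

Section division.
Variables (a1 a2 : mi n -> R[i]).
Hypotheses (h1 : translates_orthonormal a1) (h2 : translates_orthonormal a2).
Hypothesis joint_kernel : forall u, l2 u -> (forall k, l2ip (mshift k a1) u = 0) ->
  (forall k, l2ip (mshift k a2) u = 0) -> forall k, u k = 0.

Let la1 := translates_orthonormal_l2 h1.
Let la2 := translates_orthonormal_l2 h2.

(** If [c] is below [d], cancelling [c] reduces to the hypothesis on [w]. Otherwise the wanted
    number is, up to conjugation, the coefficient at [mi0] of a family [u] in the joint kernel. *)
Lemma joint_kernel_orthogonal (g w : mi n -> R[i]) : l2 g -> l2 w -> mconv a1 w = mconv a2 g ->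
  (forall d, l2ip w (mshift d a2) = 0) ->
  forall c d, l2ip (mshift c w) (mshift d a2) = 0.
Proof.
move=> lg lw e0 hw c d.
have [/mle_addP[e ->]|cd] := boolP (mle c d).
  by rewrite -mshiftD l2ip_mshift2//; exact: l2_mshift.
pose v := mshift d a2; have lcw := l2_mshift c lw.
pose u k := (l2ip (mshift k (mshift c w)) v)^*.
have lu : l2 u.
  have [B hB] := lcw; exists B; apply: bsum_le (l2b_l2ip_mshift d h2 hB) => // k.
  by rewrite normc_conj.
have ipu a j : translates_orthonormal a -> l2ip (mshift j a) u = l2ip (mshift (madd j c) (mconv a w)) v.
  move=> ha; have la := translates_orthonormal_l2 ha.
  rewrite -mshiftD -mconv_mshiftr// -mconv_mshiftl//.
  apply: usumE; apply: eq_has_sum (has_sum_l2ip_mconv_l (d := d)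
    (translates_orthonormal_mshift j ha) h2 lcw) => k.
  by congr (_ * _); exact/esym/conjCK.
have shd y j : mshift (madd j c) y d = 0.
  rewrite /mshift; case: ifP => // h; case/negP: cd.
  by apply: mle_trans h; rewrite maddC mle_add.
(* Against the translates of [a1] and [a2], [u] gives the [d]-th coefficients of [z^(j+c) g] and
   [z^(j+c) w]; these vanish because [j + c] is not below [d]. *)
have u0 : u mi0 = 0.
  apply: joint_kernel => // b; rewrite ipu//.
    by rewrite e0 -mconv_mshiftr// l2ip_mconv_mshift//; exact: l2_mshift.
  by rewrite -mconv_mshiftr// l2ip_mconv_mshift//; exact: l2_mshift.
by move/eqP: u0; rewrite /u conjC_eq0 mshift0 => /eqP.
Qed.

(** The quotient [h] is the adjoint of convolution by [a2] applied to [g1], and [w] is the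
    remainder. Expanding [mconv a1 w] along [a1], orthogonality makes every coefficient of [g]
    vanish; then [mconv a1 w = 0], and injectivity gives [w = 0]. *)
Lemma mconv_division (g1 g2 : mi n -> R[i]) : l2 g1 -> l2 g2 -> mconv a1 g1 = mconv a2 g2 ->
  exists2 h, l2 h & g1 = mconv a2 h.
Proof.
move=> lg1 lg2 e0.
pose h k := l2ip g1 (mshift k a2).
have lh : l2 h by have [B hB] := lg1; exists B; exact: bessel.
have lc1 := l2_mconv h1 lh; have lc2 := l2_mconv h2 lh.
pose w k := g1 k - mconv a2 h k; pose g k := g2 k - mconv a1 h k.
have lw : l2 w := l2B lg1 lc2; have lg : l2 g := l2B lg2 lc1.
have ewg : mconv a1 w = mconv a2 g by rewrite /w /g !mconvB e0 (mconvCA la1 la2 lh).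
have hw d : l2ip w (mshift d a2) = 0.
  by rewrite l2ipB//; [rewrite l2ip_mconv_mshift// subrr|exact: l2_mshift].
have orth := joint_kernel_orthogonal lg lw ewg hw.
have g0 d : g d = 0.
  rewrite -(l2ip_mconv_mshift d h2 lg) -ewg.
  apply: (has_sum_unique (has_sum_l2ip_mconv_l (d := d) h1 h2 lw)).
  by apply: eq_has_sum has_sum0 => k; rewrite orth mulr0.
have c0 m : mconv a1 w m = 0.
  rewrite ewg; apply: usumE; apply: eq_has_sum has_sum0 => j.
  by rewrite g0 mul0r.
exists h => //; apply/funext => d; apply/eqP; rewrite -subr_eq0; apply/eqP.
rewrite -/(w d) -(l2ip_mconv_mshift d h1 lw); apply: usumE.
by apply: eq_has_sum has_sum0 => k; rewrite c0 mul0r.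
Qed.

End division.

End taylor_product.

(** * The Hardy space *)

Section hardy_space.
Context {R : realType} {n : nat}.
Implicit Types (a b x y u v : mi n -> R[i]) (f g phi : 'rV[R[i]]_n -> R[i]).

Lemma l2_esum x : l2 x <->
  (\esum_(k in [set: mi n]) (normc (x k) ^+ 2)%:E < +oo)%E.
Proof.
split=> [[B hB]|h].
  apply: (@le_lt_trans _ _ B%:E); last exact: ltry.
  apply: ub_ereal_sup => _ [A [fA _] <-].
  by rewrite fsbig_finite//= sumEFin lee_fin; exact: hB.
have fin : (\esum_(k in [set: mi n]) (normc (x k) ^+ 2)%:E \is a fin_num)%E.
  by rewrite ge0_fin_numE// esum_ge0// => k _; rewrite lee_fin sqr_ge0.
exists (fine (\esum_(k in [set: mi n]) (normc (x k) ^+ 2)%:E)%E) => A.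
rewrite -lee_fin fineK// -sumEFin.
apply: ereal_sup_ubound; exists [set` A]; first by split.
by rewrite fsbig_finite//= set_fsetK.
Qed.

Lemma coefsE f a : taylor_coefs f a -> coefs f = a.
Proof. by move=> ha; apply: xget_unique => // b hb; exact: (taylor_coefs_uniq hb ha). Qed.

Lemma hardy2_coefs f : hardy2 f <-> exists2 a, taylor_coefs f a & l2 a.
Proof. by split=> -[a ha /l2_esum]; exists a. Qed.

Lemma hardy2_power_series x : l2 x -> hardy2 (power_series x).
Proof. by move=> lx; apply/hardy2_coefs; exists x => //; exact: taylor_power_series. Qed.

Lemma hardy2_zero : hardy2 (fun _ : 'rV[R[i]]_n => 0 : R[i]) /\
  coefs (fun _ : 'rV[R[i]]_n => 0 : R[i]) = fun=> 0.
Proof.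
have h : taylor_coefs (fun _ : 'rV[R[i]]_n => 0 : R[i]) (fun=> 0).
  by move=> z _; apply: eq_has_sum has_sum0 => k; rewrite mul0r.
split; last exact: coefsE h.
apply/hardy2_coefs; exists (fun=> 0) => //; exists 0 => A.
by rewrite big1// => k _; rewrite normc0 expr0n.
Qed.

Lemma hardy2_inner_l2ip f g a b : taylor_coefs f a -> taylor_coefs g b ->
  hardy2_inner f g = l2ip a b.
Proof. by move=> ha hb; rewrite /hardy2_inner (coefsE ha) (coefsE hb). Qed.

(** Orthogonality to the translates of [a] extends to all of [phi H^2] by [has_sum_l2ip_mconv]. *)
Lemma ker_adjoint_power_series phi a u : taylor_coefs phi a -> translates_orthonormal a ->
  l2 u -> (forall k, l2ip (mshift k a) u = 0) ->
  ker_adjoint (mul_op phi) (power_series u).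
Proof.
move=> hphi ha lu ha0; have [z0 c0] := hardy2_zero.
split; [exact: hardy2_power_series|exact: z0|move=> g /hardy2_coefs[x hx lx]].
rewrite (hardy2_inner_l2ip (taylor_mul hphi hx) (taylor_power_series lu)).
rewrite /hardy2_inner c0 (usumE (s := 0)); last first.
  by apply: eq_has_sum has_sum0 => k; rewrite rmorph0 mulr0.
apply: (has_sum_unique (has_sum_l2ip_mconv ha lx lu)).
by apply: eq_has_sum has_sum0 => k; rewrite ha0 mulr0.
Qed.

End hardy_space.

(** * Return from coefficients to functions on the polydisc *)

Theorem theorem5p5 (R : realType) (n : nat) (hn : (1 < n)%N)
    (phi1 phi2 : 'rV[R[i]]_n -> R[i])
    (hphi1 : is_inner phi1) (hphi2 : is_inner phi2)
    (hker : ker_adjoint (mul_op phi1) `&` ker_adjoint (mul_op phi2)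
            = zero_space) :
  coprime_inner phi1 phi2.
Proof.
have [a1 ha1] := inner_taylor hphi1; have [a2 ha2] := inner_taylor hphi2.
have o1 := inner_translates_orthonormal hphi1 ha1.
have o2 := inner_translates_orthonormal hphi2 ha2.
(* The hypothesis on the kernels, restated for coefficient families. *)
have zero u : l2 u -> (forall k, l2ip (mshift k a1) u = 0) ->
    (forall k, l2ip (mshift k a2) u = 0) -> forall k, u k = 0.
  move=> lu u1 u2 k.
  have : zero_space (power_series u).
    rewrite -hker; split.
      exact: ker_adjoint_power_series ha1 o1 lu u1.
    exact: ker_adjoint_power_series ha2 o2 lu u2.
  move=> h0; have hu := taylor_power_series lu.
  have h00 : taylor_coefs (fun _ : 'rV[R[i]]_n => 0 : R[i]) (fun=> 0).
    by move=> z _; apply: eq_has_sum has_sum0 => j; rewrite mul0r.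
  by rewrite (taylor_coefs_uniq hu h00 h0).
apply/seteqP; split=> f.
  move=> [[g1 /hardy2_coefs[x1 hx1 l1] f1] [g2 /hardy2_coefs[x2 hx2 l2x2] f2]].
  have e : mconv a1 x1 = mconv a2 x2.
    apply: (taylor_coefs_uniq (taylor_mul ha1 hx1) (taylor_mul ha2 hx2)) => z hz.
    by rewrite -[LHS]/(mul_op phi1 g1 z) -f1// f2.
  have [h lh eh] := mconv_division o1 o2 zero l1 l2x2 e.
  exists (power_series h); first exact: hardy2_power_series.
  move=> z hz; rewrite f1// /mul_op /= -mulrA; congr (_ * _).
  have := taylor_mul ha2 (taylor_power_series lh) hz; rewrite -eh.
  exact: has_sum_unique (hx1 z hz).
(* The converse inclusion: multiplication by an inner function preserves [hardy2], by [l2_mconv]. *)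
move=> [g /hardy2_coefs[x hx lx] fg]; split.
  exists (phi2 \* g); last by move=> z hz; rewrite fg// /mul_op /= mulrA.
  by apply/hardy2_coefs; exists (mconv a2 x); [exact: taylor_mul|exact: l2_mconv].
exists (phi1 \* g); last by move=> z hz; rewrite fg// /mul_op /= mulrA [phi2 z * _]mulrC.
by apply/hardy2_coefs; exists (mconv a1 x); [exact: taylor_mul|exact: l2_mconv].
Qed.
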